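(* Let $r=\frac{\sqrt5+1}{2}$, let $K\neq 0$ be a real number and $\hbar>0$, and let $F$ be the map on $L^2([0,2\pi])$ given by $$(F\psi)(\theta)=e^{-\frac{i}{\hbar}K H(\theta-2\pi r)}\,\psi(\theta-2\pi r),$$ where $H$ is the $2\pi$-periodic tent function and angles are taken modulo $2\pi$. For any $\psi\in L^2([0,2\pi])$ with $\|\psi\|=1$ and any $\epsilon>0$ there exists an integer $N$ such that for every iterate $F^n(\psi)=\sum_{m\in\mathbb{Z}} c^n_m e^{im\theta}$, $n\ge 1$, we have $$\sum_{|m|<N}|c^n_m|^2>1-\epsilon .$$ In particular, $\{u(F^n(\psi))\}_n$ is a bounded sequence for any such $\psi$.
   Context: $H:\mathbb{R}\to\mathbb{R}$ is the $2\pi$-periodic function with $H(\theta)=\theta-\frac{\pi}{2}$ for $0\le\theta\le\pi$ and $H(\theta)=\frac{3\pi}{2}-\theta$ for $\pi\le\theta\le 2\pi$. Elements of $L^2([0,2\pi])$ are complex-valued and regarded as $2\pi$-periodic functions of $\theta$. The norm is normalized so that for $\psi=\sum_m a_m e^{im\theta}$ one has $\|\psi\|^2=\frac{1}{2\pi}\int_0^{2\pi}|\psi|^2\,d\theta=\sum_m|a_m|^2$. $F^n$ denotes the $n$-fold composition of $F$. For $\psi=\sum_m a_m e^{im\theta}$ with $\|\psi\|=1$, define $u(\psi)=\sup\{m\in\mathbb{Z}:\ \sum_{|j|\le m}|a_j|^2\le \frac12\}$ (the sum is empty, hence $0$, for $m<0$). *)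

(* Defs.v *)
From mathcomp Require Export all_boot all_order all_algebra.
From mathcomp Require Export complex.
From mathcomp Require Export all_classical all_reals all_analysis.
From mathcomp Require Import ring lra.

Set Implicit Arguments.
Unset Strict Implicit.
Unset Printing Implicit Defensive.

Export Order.TTheory GRing.Theory Num.Theory ComplexField.Normc.

Local Open Scope classical_set_scope.
Local Open Scope ring_scope.

Section Defs.
Variable R : realType.
Implicit Types (psi f : R -> R[i]) (K hbar x t : R) (m n : int).

Definition expi x : R[i] := Complex (cos x) (sin x).

(* Restricted to one period, this is the function equal to t - pi/2 on [0, pi]
   and to 3pi/2 - t on [pi, 2pi]; see tent_periodic, tentl and tentr below. *)
Definition tent x : R :=
  let t := x - 2 * pi * (Num.floor (x / (2 * pi)))%:~R in
  if t <= pi then t - pi / 2 else 3 * pi / 2 - t.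

Definition integralC f : R[i] :=
  Complex (\int[lebesgue_measure]_(t in `[0, 2 * pi]) complex.Re (f t))
          (\int[lebesgue_measure]_(t in `[0, 2 * pi]) complex.Im (f t)).

(* Elements of L^2([0, 2pi]) are handled through Borel, everywhere 2pi-periodic
   representatives; the norm and the Fourier coefficients below do not depend
   on the representative. *)
Definition L2per psi : Prop :=
  [/\ periodic psi (2 * pi),
      measurable_fun [set: R] (fun t => complex.Re (psi t)),
      measurable_fun [set: R] (fun t => complex.Im (psi t)) &
      lebesgue_measure.-integrable `[0, 2 * pi]
        (fun t => (normc (psi t) ^+ 2)%:E)].

Definition L2norm psi : R :=
  Num.sqrt ((2 * pi)^-1 *
    \int[lebesgue_measure]_(t in `[0, 2 * pi]) (normc (psi t) ^+ 2)).

Definition fourier_coef psi m : R[i] :=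
  real_complex R (2 * pi)^-1 * integralC (fun t => psi t * expi (- (m%:~R * t))).

Definition golden : R := (Num.sqrt 5 + 1) / 2.

Definition Fmap K hbar psi : R -> R[i] := fun t =>
  expi (- (K / hbar * tent (t - 2 * pi * golden))) * psi (t - 2 * pi * golden).

(* Extended-real valued, so that no junk value arises should the set be
   unbounded above. *)
Definition u psi : \bar R :=
  ereal_sup [set (m%:~R)%:E | m in [set m : int |
    \sum_(j \in [set j : int | `|j| <= m]) normc (fourier_coef psi j) ^+ 2
      <= 1 / 2]].

Let twopi_gt0 : 0 < 2 * pi :> R.
Proof. by rewrite mulr_gt0// pi_gt0. Qed.

Lemma tent_periodic : periodic tent (2 * pi).
Proof.
move=> x; rewrite /tent [(x + _) / _]mulrDl divff ?gt_eqF//.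
rewrite floorDrz ?rpred1// floor1.
rewrite rmorphD/= mulr1z.
by set k := _%:~R; have -> : x + 2 * pi - 2 * pi * (k + 1) = x - 2 * pi * k by ring.
Qed.

Let floor0 t : 0 <= t < 2 * pi -> Num.floor (t / (2 * pi)) = 0.
Proof.
move=> /andP[t0 t2]; apply/floor_def/andP; split.
  by apply: divr_ge0 => //; exact: ltW.
by rewrite ltr_pdivrMr// mul1r.
Qed.

Lemma tentl t : 0 <= t <= pi -> tent t = t - pi / 2.
Proof.
move=> /andP[t0 tpi]; have pi0 := pi_gt0 R.
rewrite /tent floor0 ?mulr0z ?mulr0 ?subr0 ?tpi//.
by apply/andP; split=> //; lra.
Qed.

Lemma tentr t : pi <= t <= 2 * pi -> tent t = 3 * pi / 2 - t.
Proof.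
move=> /andP[pit t2pi]; have pi0 := pi_gt0 R.
have [->|tN] := eqVneq t (2 * pi).
  by rewrite -[X in tent X]add0r tent_periodic tentl ?lexx ?pi_ge0//; lra.
have [->|tNpi] := eqVneq t pi; first by rewrite tentl ?lexx ?pi_ge0//; lra.
have t2 : t < 2 * pi by rewrite lt_neqAle tN.
rewrite /tent floor0 ?t2 ?andbT; last by lra.
by rewrite mulr0z mulr0 subr0 leNgt lt_neqAle eq_sym tNpi pit.
Qed.

End Defs.

(* Main.v *)
From HB Require Import structures.
Require Import Defs.
From mathcomp Require Import measurable_realfun.
From mathcomp Require Import ring lra zify.
Import numFieldNormedType.Exports.

(** The orbit of [psi] is totally bounded in L^2, and a totally bounded set of
functions has uniformly small Fourier tails.

With S_n(t) the sum of [tent (t - 2 pi k r)] over 1 <= k <= n, one has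
F^n f (t) = exp(- i K/hbar S_n(t)) f (t - 2 pi n r), so F is a linear isometry
for the uniform norm and for the L^2 norm.  Let q run through 1, 3, 8, 21, ...,
every other Fibonacci number: q r lies within 1/q of an integer, always on the
same side of it.  The heart of the matter is [sum_zigzag_golden]: the Birkhoff
sums S_q are O(log q / q), uniformly in t.  Hence, for a trigonometric
polynomial P, F^q P is uniformly within O(log q / q) of P, and these errors are
summable along the sequence of the q (the lemmas record the weaker but still
summable bound (l + 1) / 2^l for the l-th of them).  Every n is a sum of such q,
each taken at most twice ([greedy_decomposition]); stripping off the large ones
shows that F^n P is uniformly close to one of finitely many F^j P
([Fmap_almost_periodic]).  Now approximate [psi] by P, and each of these F^j P
by a trigonometric polynomial ([trigpoly_dense]): since F is an isometry, all
the F^n psi are L^2-close to trigonometric polynomials of one common degree N.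
Finally the coefficients of frequency at most N of any f carry at least
||f||^2 - ||f - Q||^2 when Q has degree at most N ([best_approximation]).

The bound on S_q is of Denjoy-Koksma type, but it needs one cancellation more
than the classical inequality, which only gives O(1).  Rescaled to the
circle of length 1, the tent has slope +1 or -1 alternately, a square wave
governed by the parity of floor(2 x).  The q first points of the orbit lie, one
for one, less than 1/q beyond the vertices of a regular q-gon.  As floor(2 x) is
monotone and grows by 2 per turn, sliding the points from the vertices to the
orbit alters the sum of the square wave by at most 4, and over a regular q-gon
that sum is at most 2 by antisymmetry; so it is bounded for these q and, by the
greedy decomposition, O(log q) for every length up to q.  The k-th point is
slid by k d with 0 <= d <= 1/q^2, so S_q differs from the sum of the tent over
the polygon, itself O(1/q), by d times the sum of k times the k-th slope;
summation by parts bounds this by d q O(log q) = O(log q / q). *)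

Set Implicit Arguments.
Unset Strict Implicit.
Unset Printing Implicit Defensive.

Local Open Scope classical_set_scope.
Local Open Scope ring_scope.

(** * The tent function and its slope *)

Section Wave.
Variable R : realType.
Implicit Types x y t : R.

Definition halves x : int := Num.floor (2 * x).
Definition wave x : R := (-1) ^ halves x.

(** The tent function in units where the circle has length 1 ([zigzag_tent]).
    This formula makes the antiperiodicity and the slope apparent; it hides
    the continuity, recovered in [zigzag_lip]. *)
Definition zigzag x : R := wave x * (x - (halves x)%:~R / 2 - 1 / 4).

Lemma halvesD x (m : int) : halves (x + m%:~R / 2) = halves x + m.
Proof.
rewrite /halves; have -> : 2 * (x + m%:~R / 2) = 2 * x + m%:~R :> R by field.
by rewrite floorDrz ?intr_int// intrKfloor.
Qed.

Lemma halves_le x y : x <= y -> halves x <= halves y.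
Proof. by move=> xy; apply: le_floor; lra. Qed.

Lemma halves_itv x : 0 <= x - (halves x)%:~R / 2 < 1 / 2.
Proof.
rewrite /halves; have /andP[] := floor_itv (2 * x); rewrite rmorphD/= mulr1z.
by move=> *; apply/andP; split; lra.
Qed.

Lemma norm_wave x : `|wave x| = 1.
Proof. by rewrite /wave expN1r normrX normrN1 expr1n. Qed.

Lemma wave_antiperiodic x : wave (x + 1 / 2) = - wave x.
Proof.
rewrite /wave (halvesD x 1) exprzDr ?unitrN ?unitr1// expr1z; ring.
Qed.

Lemma zigzag_antiperiodic x : zigzag (x + 1 / 2) = - zigzag x.
Proof.
rewrite /zigzag wave_antiperiodic (halvesD x 1) rmorphD/= mulr1z; ring.
Qed.

Lemma antiperiodic_periodic (f : R -> R) :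
  (forall x, f (x + 1 / 2) = - f x) -> forall x, f (x + 1) = f x.
Proof.
by move=> fa x; rewrite -[RHS]opprK -!fa; congr f; field.
Qed.

(** Bounding the variation by increments of the monotone [halves] is what
    makes the bounds for consecutive intervals telescope, in [sum_jump]. *)
Lemma wave_diff x y : x <= y ->
  `|wave y - wave x| <= 2 * (halves y - halves x)%:~R.
Proof.
move=> xy; have := halves_le xy; rewrite le_eqVlt => /predU1P[exy|lxy].
  by rewrite /wave exy !subrr normr0 mulr0.
have j1 : 1 <= (halves y - halves x)%:~R :> R by rewrite (ler_int R 1) -gtz0_ge1; lia.
by apply: (le_trans (ler_normB _ _)); rewrite !norm_wave; lra.
Qed.

(** The index [j] counts the break points crossed.  Two break points are half a
    unit apart, so a step that crosses two of them is at least 1/2, which is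
    the whole oscillation of the function. *)
Lemma zigzag_lip x t : 0 <= t -> `|zigzag (x + t) - zigzag x| <= t.
Proof.
move=> t0; have := @halves_le x (x + t); rewrite lerDl => /(_ t0).
have := halves_itv x; have := halves_itv (x + t).
rewrite /zigzag /wave; set m := halves x; set n := halves (x + t).
have [j ->] : exists j, n = m + j by exists (n - m); ring.
rewrite exprzDr ?unitrN ?unitr1// lerDl.
have := norm_wave x; rewrite /wave -/m; set s := (-1) ^ m => s1.
case: j => // -[|[|j]] + + _; rewrite ?rmorphD/= => /andP[a1 a2] /andP[b1 b2].
- have -> : s * (-1) ^ (Posz 0) * (x + t - (m%:~R + 0%:~R) / 2 - 1 / 4) -
    s * (x - m%:~R / 2 - 1 / 4) = s * t.
    by rewrite expr0z; field.
  by rewrite normrM s1 mul1r ger0_norm.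
- have -> : s * (-1) ^ (Posz 1) * (x + t - (m%:~R + 1%:~R) / 2 - 1 / 4) -
    s * (x - m%:~R / 2 - 1 / 4) = s * (1 + m%:~R - 2 * x - t).
    by rewrite expr1z; field.
  rewrite normrM s1 mul1r ler_norml; apply/andP; split; lra.
- have j2 : 2 <= j.+2%:~R :> R by rewrite (ler_int R 2).
  have : `|(-1) ^ Posz j.+2 : R| = 1 by rewrite expN1r normrX normrN1 expr1n.
  move: ((-1) ^ _ : R) => e e1.
  apply: (le_trans (ler_normB _ _)); rewrite !normrM !s1 e1 !mul1r.
  set u := _ - _ - _; set v := _ - _ - _.
  have : `|u| <= 1 / 4 by rewrite ler_norml; apply/andP; split; rewrite /u; lra.
  have : `|v| <= 1 / 4 by rewrite ler_norml; apply/andP; split; rewrite /v; lra.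
  lra.
Qed.

(** Where [halves] does not jump the function is affine with slope [wave], so
    the left side vanishes; elsewhere both the increment and [t * c] are at
    most [t].  The slope may be read at either end of the step. *)
Lemma zigzag_slope x t (c : R) : 0 <= t ->
  c = wave x \/ c = wave (x + t) ->
  `|zigzag (x + t) - zigzag x - t * c| <=
    2 * t * (halves (x + t) - halves x)%:~R.
Proof.
move=> t0 hc; have := @halves_le x (x + t); rewrite lerDl => /(_ t0).
rewrite le_eqVlt => /predU1P[exy|lxy].
  have ew : wave (x + t) = wave x by rewrite /wave exy.
  have -> : c = wave x by case: hc => //; rewrite ew.
  rewrite /zigzag ew -exy subrr mulr0 normr_le0; apply/eqP; ring.
have j1 : 1 <= (halves (x + t) - halves x)%:~R :> R.
  by rewrite (ler_int R 1) -gtz0_ge1; lia.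
have c1 : `|c| = 1 by case: hc => ->; exact: norm_wave.
apply: (le_trans (ler_normB _ _)); rewrite normrM c1 (ger0_norm t0).
by have := zigzag_lip x t0; nra.
Qed.

Lemma zigzag_tent x : tent (2 * pi * x) = 2 * pi * zigzag x.
Proof.
have pi0 := pi_gt0 R; rewrite /tent; have -> : 2 * pi * x / (2 * pi) = x.
  by rewrite mulrC mulKf// mulf_neq0// gt_eqF.
have even1 (k : int) : (-1) ^ (2 * k) = 1 :> R.
  by rewrite -exprz_exp -exprnP sqrrN !expr1n exp1rz.
rewrite /zigzag /wave; have := halves_itv x.
set m := Num.floor x; have /andP[m1 m2] := floor_itv x; rewrite -/m in m1 m2.
have -> : 2 * pi * x - 2 * pi * m%:~R = pi * (2 * (x - m%:~R)) by ring.
move: m2; rewrite rmorphD/= mulr1z => m2.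
have [xm|xm] := ltP (x - m%:~R) (1 / 2).
  have -> : halves x = 2 * m.
    by apply: floor_def; rewrite rmorphD rmorphM/= mulr1z; apply/andP; split; lra.
  rewrite ifT; last by rewrite ger_pMr//; lra.
  by rewrite even1 rmorphM/= => _; field.
have -> : halves x = 2 * m + 1.
  by apply: floor_def; rewrite !rmorphD rmorphM/= mulr1z; apply/andP; split; lra.
rewrite exprzDr ?unitrN ?unitr1// even1 expr1z rmorphD rmorphM/= mulr1z => _.
case: leP; last by move=> _; field.
rewrite ger_pMr// => h; have -> : x = m%:~R + 1 / 2 by lra.
by field.
Qed.

Lemma zigzag_dist x y : `|zigzag x - zigzag y| <= `|x - y|.
Proof.
wlog xy : x y / y <= x.
  move=> hw; have [|/ltW] := leP y x; first exact: hw.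
  by move=> xy; rewrite distrC [leRHS]distrC; exact: hw.
have d0 : 0 <= x - y by rewrite subr_ge0.
by rewrite [leRHS]ger0_norm// -{1}(subrKC y x) zigzag_lip.
Qed.

Lemma continuous_zigzag : continuous zigzag.
Proof.
move=> x; apply/cvgrPdist_le => e e0; near=> y.
apply: (le_trans (zigzag_dist x y)); near: y.
by apply: cvgr_dist_le.
Unshelve. all: by end_near. Qed.

End Wave.

(** * Birkhoff sums over a rotation close to a rational one *)

Section Equidistribution.
Variable R : realType.
Implicit Types (x y t beta : R) (q s : nat).

(** A function of period 1 sees [a k / q] only through [a k] modulo [q], and
    injectivity makes these residues run over all classes. *)
Lemma sum_residues (f : R -> R) q (a : nat -> nat) x :
  (forall y, f (y + 1) = f y) ->
  (forall i j, (i < q)%N -> (j < q)%N -> a i = a j %[mod q] -> i = j) ->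
  \sum_(k < q) f (x + (a k)%:R / q%:R) = \sum_(k < q) f (x + k%:R / q%:R).
Proof.
case: q => [|q] fp ainj; first by rewrite !big_ord0.
pose h (k : 'I_q.+1) := inord (a k %% q.+1) : 'I_q.+1.
have hE k : h k = (a k %% q.+1)%N :> nat by rewrite inordK// ltn_mod.
have hinj : injective h.
  by move=> i j /(congr1 val)/=; rewrite !hE => /ainj e; apply/val_inj/e.
rewrite [RHS](reindex_inj hinj)/=; apply: eq_bigr => k _.
rewrite hE {1}(divn_eq (a k) q.+1) natrD natrM.
have -> : x + ((a k %/ q.+1)%:R * q.+1%:R + (a k %% q.+1)%:R) / q.+1%:R =
    x + (a k %% q.+1)%:R / q.+1%:R + 1 *+ (a k %/ q.+1).
  by field; rewrite nat1r pnatr_eq0.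
exact: periodicn.
Qed.

Lemma sum_coprime (f : R -> R) q s x : (forall y, f (y + 1) = f y) ->
  coprime s q ->
  \sum_(k < q) f (x + k%:R * (s%:R / q%:R)) = \sum_(k < q) f (x + k%:R / q%:R).
Proof.
move=> fp cop; rewrite -(@sum_residues _ _ (fun k => k * s)%N)//.
  by apply: eq_bigr => k _; rewrite natrM mulrA.
move=> i j iq jq /eqP; have [ij|/ltnW ij] := leqP i j.
  rewrite eq_sym eqn_mod_dvd ?leq_mul2r ?ij ?orbT// -mulnBl Gauss_dvdl 1?coprime_sym//.
  by move=> /dvdnP[[|c]]; nia.
rewrite eqn_mod_dvd ?leq_mul2r ?ij ?orbT// -mulnBl Gauss_dvdl 1?coprime_sym//.
by move=> /dvdnP[[|c]]; nia.
Qed.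

Lemma sum_shift (f : R -> R) q m x : (forall y, f (y + 1) = f y) ->
  \sum_(k < q) f (x + (k + m)%:R / q%:R) = \sum_(k < q) f (x + k%:R / q%:R).
Proof.
move=> fp; apply: (@sum_residues _ _ (fun k => k + m)%N) => // i j iq jq.
by move/eqP; rewrite eqn_modDr !modn_small// => /eqP.
Qed.

(** The number of break points of the tent in the step of length [1 / q]
    starting at [x]. *)
Definition jump q x : int := halves (x + q%:R^-1) - halves x.

(** The [q] steps tile one turn, which contains two break points. *)
Lemma sum_jump q x : (0 < q)%N ->
  \sum_(k < q) (jump q (x + k%:R / q%:R))%:~R = 2 :> R.
Proof.
move=> q0; have q0' : q%:R != 0 :> R by rewrite pnatr_eq0 -lt0n.
rewrite -(big_mkord xpredT (fun k => (jump q (x + k%:R / q%:R))%:~R)).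
rewrite (GRing.telescope_sumr_eq (fun k => (halves (x + k%:R / q%:R))%:~R))//.
  rewrite divff// mul0r addr0 -rmorphB/=.
  have -> : x + 1 = x + 2%:~R / 2 by field.
  by rewrite halvesD addrAC subrr add0r.
move=> k _; rewrite /jump rmorphB/=; congr (_%:~R - _).
by congr halves; rewrite -natr1; field.
Qed.

Lemma jump_periodic q x : jump q (x + 1) = jump q x.
Proof.
have e y : y + 1 = y + 2%:~R / 2 by field.
by rewrite /jump addrAC !e !halvesD; ring.
Qed.

Lemma halves_jump q x t : 0 <= t <= q%:R^-1 ->
  (halves (x + t) - halves x)%:~R <= (jump q x)%:~R :> R.
Proof.
by move=> /andP[t0 tq]; rewrite ler_int lerD2r halves_le// lerD2l.
Qed.

(** Half a turn maps the regular [q]-gon to itself when [q] is even ([t = 0])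
    and to the polygon turned by half a side when [q] is odd
    ([t = 1 / (2 q)]). *)
Lemma sum_antiperiodic (f : R -> R) q x : (0 < q)%N ->
  (forall y, f (y + 1 / 2) = - f y) ->
  exists2 t, 0 <= t <= q%:R^-1 &
    \sum_(k < q) f (x + k%:R / q%:R + t) = - \sum_(k < q) f (x + k%:R / q%:R).
Proof.
move=> q0 fa; have q0' : q%:R != 0 :> R by rewrite pnatr_eq0 -lt0n.
have q1 : 0 <= q%:R^-1 :> R by rewrite invr_ge0 ler0n.
exists ((odd q)%:R / 2 / q%:R).
  by case: (odd q) => /=; rewrite ?mul0r; apply/andP; split; lra.
rewrite -sumrN; under [RHS]eq_bigr do rewrite -fa.
have q2 : q%:R / 2 = (odd q)%:R / 2 + (q./2)%:R :> R.
  by rewrite -{1}(odd_double_half q) -muln2 natrD natrM; field.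
under [LHS]eq_bigr do rewrite addrAC.
rewrite -[LHS](sum_shift _ q./2); last exact: antiperiodic_periodic.
apply: eq_bigr => k _; congr f.
rewrite -!addrA; congr (_ + _); rewrite natrD addrC.
have -> : 1 / 2 = ((odd q)%:R / 2 + (q./2)%:R) / q%:R :> R by rewrite -q2; field.
by field.
Qed.

(** By [sum_antiperiodic] the sum changes sign under a rotation by less than a
    step, yet such a rotation crosses only two jumps of height 2. *)
Lemma sum_wave_rational q x : (0 < q)%N ->
  `|\sum_(k < q) wave (x + k%:R / q%:R)| <= 2.
Proof.
move=> q0; have [t /andP[t0 tq] e] := sum_antiperiodic x q0 (@wave_antiperiodic R).
set S := \sum_(k < q) wave (x + k%:R / q%:R) in e *.
have dbl : `|- S - S| = 2 * `|S| by rewrite -opprD normrN -mulr2n normrMn mulr_natl.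
suff: `|- S - S| <= 4 by rewrite dbl; lra.
rewrite -{1}e /S -sumrB; apply: (le_trans (ler_norm_sum _ _ _)).
have -> : 4 = 2 * 2 :> R by ring.
rewrite -{2}(sum_jump x q0) mulr_sumr; apply: ler_sum => k _.
apply: (le_trans (wave_diff _)); first by lra.
by rewrite ler_pM2l//; apply: halves_jump; rewrite t0.
Qed.

(** The sum changes sign under a rotation by [t <= 1 / q], while its variation
    is [t] times the sum of the slopes, bounded by [sum_wave_rational], plus
    the contribution of the two steps that meet a break point. *)
Lemma sum_zigzag_rational q x : (0 < q)%N ->
  `|\sum_(k < q) zigzag (x + k%:R / q%:R)| <= 3 / q%:R.
Proof.
move=> q0; have q1 : 0 < q%:R^-1 :> R by rewrite invr_gt0 ltr0n.
have [t /andP[t0 tq] e] := sum_antiperiodic x q0 (@zigzag_antiperiodic R).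
set S := \sum_(k < q) zigzag (x + k%:R / q%:R) in e *.
have dbl : `|- S - S| = 2 * `|S| by rewrite -opprD normrN -mulr2n normrMn mulr_natl.
suff: `|- S - S| <= 6 / q%:R by rewrite dbl; lra.
rewrite -{1}e /S -sumrB; set W := \sum_(k < q) wave (x + k%:R / q%:R).
have -> : \sum_(k < q) (zigzag (x + k%:R / q%:R + t) - zigzag (x + k%:R / q%:R))
  = t * W + \sum_(k < q) (zigzag (x + k%:R / q%:R + t) - zigzag (x + k%:R / q%:R)
       - t * wave (x + k%:R / q%:R)).
  by rewrite mulr_sumr -big_split/=; apply: eq_bigr => k _; ring.
apply: (le_trans (ler_normD _ _)).
have W2 : `|W| <= 2 by exact: sum_wave_rational.
have -> : 6 / q%:R = q%:R^-1 * 2 + 2 * q%:R^-1 * 2 :> R by ring.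
apply: lerD; first by rewrite normrM ger0_norm// ler_pM.
apply: (le_trans (ler_norm_sum _ _ _)).
rewrite -{2}(sum_jump x q0) mulr_sumr; apply: ler_sum => k _.
apply: (le_trans (zigzag_slope t0 _)); first by left.
apply: ler_pM; [by lra| |by lra|by apply: halves_jump; rewrite t0].
by rewrite ler0z subr_ge0 halves_le// lerDl.
Qed.

(** The approximation is from below, so that the first [q] points [k * beta]
    all lie beyond the vertices [k * s / q], by less than one side. *)
Definition approximant beta q s : Prop :=
  [/\ (0 < q)%N, coprime s q & 0 <= beta - s%:R / q%:R <= q%:R^-1 ^+ 2].

Lemma approximant_step beta q s k : approximant beta q s -> (k < q)%N ->
  0 <= k%:R * (beta - s%:R / q%:R) <= q%:R^-1.
Proof.
move=> [q0 _ /andP[d0 d1]] kq; rewrite mulr_ge0//=.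
have q1 : 0 < q%:R :> R by rewrite ltr0n.
have kq' : k%:R <= q%:R :> R by rewrite ler_nat ltnW.
apply: (@le_trans _ _ (q%:R * q%:R^-1 ^+ 2)); first by rewrite ler_pM.
by rewrite expr2 mulrA divff ?mul1r// gt_eqF.
Qed.

Lemma sum_jump_approximant beta q s x : approximant beta q s ->
  \sum_(k < q) (jump q (x + k%:R * (s%:R / q%:R)))%:~R = 2 :> R.
Proof.
move=> [q0 cop _]; rewrite -(sum_jump x q0).
apply: (@sum_coprime (fun y => (jump q y)%:~R)) => // y.
by rewrite jump_periodic.
Qed.

(** The Denjoy-Koksma inequality for the square wave: each orbit point is
    compared with its vertex, and the jumps crossed in total are those of one
    turn. *)
Lemma sum_wave_approximant beta q s x : approximant beta q s ->
  `|\sum_(k < q) wave (x + k%:R * beta)| <= 6.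
Proof.
move=> app; have [q0 cop _] := app.
pose y k := x + k%:R * (s%:R / q%:R); pose d := beta - s%:R / q%:R.
have -> : \sum_(k < q) wave (x + k%:R * beta) = \sum_(k < q) wave (y k) +
    \sum_(k < q) (wave (y k + k%:R * d) - wave (y k)).
  rewrite -big_split/=; apply: eq_bigr => k _.
  by rewrite addrC subrK; congr wave; rewrite /y /d; ring.
apply: (le_trans (ler_normD _ _)).
have -> : 6 = 2 + 2 * 2 :> R by ring.
apply: lerD.
  rewrite /y (sum_coprime _ _ cop); first exact: sum_wave_rational.
  exact/antiperiodic_periodic/wave_antiperiodic.
apply: (le_trans (ler_norm_sum _ _ _)).
rewrite -{2}(sum_jump_approximant x app) mulr_sumr; apply: ler_sum => k _.
have /andP[t0 tq] := approximant_step app (ltn_ord k).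
apply: (le_trans (wave_diff _)); first by rewrite lerDl.
by rewrite ler_pM2l//; apply: halves_jump; rewrite t0.
Qed.

(** Summation by parts: [k] is the number of [1 <= j <= k], so the weighted sum
    is the sum of the tails. *)
Lemma weighted_sum_le (a : nat -> R) (q : nat) (C : R) :
  (forall j, (j <= q)%N -> `|\sum_(j <= k < q) a k| <= C) ->
  `|\sum_(k < q) k%:R * a k| <= q%:R * C.
Proof.
move=> aC.
have -> : \sum_(k < q) k%:R * a k = \sum_(1 <= j < q) \sum_(j <= k < q) a k.
  rewrite -(big_mkord xpredT (fun k => k%:R * a k)).
  elim: {aC} q => [|q IH]; first by rewrite !big_geq.
  rewrite big_nat_recr//= IH; case: q {IH} => [|q]; first by rewrite !big_geq// mul0r add0r.
  rewrite [in RHS]big_nat_recr//= big_nat1.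
  under [in RHS]eq_big_nat => j /andP[_ jq] do rewrite big_nat_recr/= 1?ltnW//.
  rewrite big_split/= -addrA; congr (_ + _).
  by rewrite sumr_const_nat subn1/= -mulr_natl -natr1; ring.
case: q aC => [|q] aC; first by rewrite big_geq// normr0 mul0r.
apply: (le_trans (ler_norm_sum _ _ _)).
apply: (@le_trans _ _ (\sum_(1 <= j < q.+1) C)).
  by apply: ler_sum_nat => j /andP[_ jq]; rewrite aC// ltnW.
have C0 : 0 <= C by apply: le_trans (aC q.+1 (leqnn _)).
by rewrite sumr_const_nat subn1/= -[C *+ q]mulr_natl ler_wpM2r// ler_nat.
Qed.

(** The sum over the orbit is the sum over the vertices, plus the first-order
    displacement [d * k * slope], plus the errors at the break points.  The
    slopes are taken at the orbit points, not at the vertices, so that [C] is a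
    bound for orbit segments. *)
Lemma sum_zigzag_approximant beta q s x (C : R) : approximant beta q s ->
  (forall y j, (j <= q)%N -> `|\sum_(k < j) wave (y + k%:R * beta)| <= C) ->
  `|\sum_(k < q) zigzag (x + k%:R * beta)| <= (C + 7) / q%:R.
Proof.
move=> app hC; have [q0 cop /andP[d0 d1]] := app.
have q1 : 0 < q%:R^-1 :> R by rewrite invr_gt0 ltr0n.
pose y k := x + k%:R * (s%:R / q%:R); set d := beta - s%:R / q%:R in d0 d1 *.
have yE k : y k + k%:R * d = x + k%:R * beta by rewrite /y /d; ring.
have -> : \sum_(k < q) zigzag (x + k%:R * beta) = \sum_(k < q) zigzag (y k) +
    d * \sum_(k < q) (k%:R * wave (x + k%:R * beta)) +
    \sum_(k < q) (zigzag (y k + k%:R * d) - zigzag (y k) - k%:R * d * wave (x + k%:R * beta)).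
  by rewrite mulr_sumr -!big_split/=; apply: eq_bigr => k _; rewrite yE; ring.
have -> : (C + 7) / q%:R = 3 / q%:R + q%:R^-1 ^+ 2 * (q%:R * C) + 2 * q%:R^-1 * 2.
  by field; rewrite pnatr_eq0 -lt0n.
apply: (le_trans (ler_normD _ _)); apply: lerD.
  apply: (le_trans (ler_normD _ _)); apply: lerD.
    rewrite /y (sum_coprime _ _ cop); first exact: sum_zigzag_rational.
    exact/antiperiodic_periodic/zigzag_antiperiodic.
  rewrite normrM ger0_norm// ler_pM//.
  apply: (@weighted_sum_le (fun k => wave (x + k%:R * beta))) => j jq.
  rewrite -{1}(add0n j) big_addn big_mkord.
  have -> : \sum_(k < q - j) wave (x + (k + j)%:R * beta) =
      \sum_(k < q - j) wave (x + j%:R * beta + k%:R * beta).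
    by apply: eq_bigr => k _; congr wave; rewrite natrD; ring.
  by apply: hC; rewrite leq_subr.
apply: (le_trans (ler_norm_sum _ _ _)).
rewrite -{2}(sum_jump_approximant x app) mulr_sumr; apply: ler_sum => k _.
have /andP[t0 tq] := approximant_step app (ltn_ord k).
apply: (le_trans (zigzag_slope t0 _)); first by right; rewrite yE.
apply: ler_pM; [by rewrite mulr_ge0| |by rewrite ler_pM2l|by apply: halves_jump; rewrite t0].
by rewrite ler0z subr_ge0 halves_le// lerDl.
Qed.

End Equidistribution.

(** * The golden rotation *)

(** The pairs of consecutive Fibonacci numbers with indices [2 l] and
    [2 l + 1]; thus [num l] and [den l] have indices [2 l] and [2 l + 2]. *)
Definition fibs l : nat * nat :=
  iter l (fun p => (p.1 + p.2, p.1 + p.2.*2)%N) (0, 1)%N.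

Definition num l : nat := (fibs l).1.
Definition den l : nat := (fibs l.+1).1.

(** The norm form of the golden field takes the value 1 along these pairs. *)
Lemma fibs_norm l : let: (s, d) := fibs l in (d ^ 2 = s ^ 2 + s * d + 1)%N.
Proof.
rewrite /fibs; elim: l => //= l; case: (iter l _ _) => s d /=; rewrite -!mul2n.
nia.
Qed.

Lemma den_bounds l : (2 * den l <= den l.+1 <= 3 * den l)%N.
Proof. by rewrite /den /=; lia. Qed.

Lemma den_ge l : (2 ^ l <= den l)%N.
Proof.
elim: l => // l IH; rewrite expnS.
by have /andP[h _] := den_bounds l; apply: leq_trans h; rewrite leq_mul2l.
Qed.

Lemma den_gt0 l : (0 < den l)%N.
Proof. by apply: leq_trans (den_ge l); rewrite expn_gt0. Qed.

Lemma num_den l : (num l ^ 2 + den l ^ 2 = 3 * num l * den l + 1)%N /\ (num l <= den l)%N.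
Proof.
rewrite /den /num /=; have := fibs_norm l.
by case: (fibs l) => s d /= h; split; nia.
Qed.

Lemma coprime_num_den l : coprime (num l) (den l).
Proof.
have [h _] := num_den l; rewrite /coprime -dvdn1.
have := dvdn_gcdl (num l) (den l); have := dvdn_gcdr (num l) (den l).
set g := gcdn _ _ => gd gn.
rewrite -(@dvdn_addr (3 * num l * den l) g 1); last exact: dvdn_mull.
by rewrite -h dvdn_add// expnS expn1 dvdn_mull.
Qed.

(** Numeration in the base 1, 3, 8, 21, ...: as [den] at most triples, the
    digits are 0, 1 or 2.  [A n c] is meant for: some quantity attached to a
    time shift by [n] is at most [c]; such costs add up along the expansion,
    and only the part of [n] below [den L] is left over. *)
Lemma greedy_decomposition (R : realType) (A : nat -> R -> Prop) (e : nat -> R) (L : nat) :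
  A 0%N 0 -> (forall m n a b, A m a -> A n b -> A (m + n)%N (a + b)) ->
  (forall n a b, A n a -> a <= b -> A n b) ->
  (forall l, 0 <= e l) -> (forall l, A (den l) (e l)) ->
  forall i n, (n < den (L + i))%N ->
    exists j k, [/\ (j < den L)%N, n = (k + j)%N &
      A k (\sum_(L <= l < L + i) 2 * e l)].
Proof.
move=> A0 AD Ale e0 Ae; elim=> [|i IH] n.
  by rewrite addn0 => ni; exists n, 0%N; rewrite big_geq.
rewrite addnS => ni; set q := den (L + i).
have q0 : (0 < q)%N := den_gt0 _.
have [j [k [jL nE Ak]]] := IH _ (ltn_pmod n q0).
exists j, (n %/ q * q + k)%N; split => //.
  by rewrite -addnA -nE -divn_eq.
rewrite big_nat_recr/= ?leq_addr// addrC; apply: (AD) => //.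
have : (n %/ q <= 2)%N.
  rewrite -ltnS ltn_divLR//; apply: leq_trans ni _.
  by have /andP[] := den_bounds (L + i).
have := Ae (L + i)%N; have := e0 (L + i)%N; rewrite -/q.
case: (n %/ q)%N => [|[|[|]]]// e0' Ae' _.
- by apply: Ale A0 _; lra.
- by rewrite mul1n; apply: Ale Ae' _; lra.
- by rewrite mul2n -addnn; apply: Ale (AD _ _ _ _ Ae' Ae') _; lra.
Qed.

Section Golden.
Variable R : realType.
Implicit Types (x : R).

Lemma golden_bounds : 3 / 2 <= golden R <= 2 /\ golden R ^+ 2 = golden R + 1.
Proof.
have h5 : Num.sqrt 5 ^+ 2 = 5 :> R by rewrite sqr_sqrtr.
have h0 : 0 <= Num.sqrt 5 :> R by exact: sqrtr_ge0.
rewrite /golden; split; first by apply/andP; split; nra.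
by rewrite expr_div_n sqrrD h5; field.
Qed.

(** The product of [q * (2 - g) - s] with its conjugate [q * (1 + g) - s] is 1
    by the norm equation, and the conjugate is at least [q]. *)
Lemma approximant_golden l : approximant (2 - golden R) (den l) (num l).
Proof.
split; [exact: den_gt0|exact: coprime_num_den|].
have [h sq] := num_den l; have q0 := den_gt0 l.
move: (den l) (num l) h sq q0 => q s /(congr1 (fun n => n%:R : R)).
rewrite !natrD !natrX !natrM -(ler_nat R) -(ltr0n R).
have := ler0n R s; move: (q%:R : R) (s%:R : R) => {}q {}s s0 h sq q0.
have [/andP[g1 g2] gg] := golden_bounds; set g := golden R in g1 g2 gg *.
have e : (q * (2 - g) - s) * (q * (1 + g) - s) = 1.
  have -> : (q * (2 - g) - s) * (q * (1 + g) - s) =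
    q ^+ 2 * (2 + g - g ^+ 2) - 3 * s * q + s ^+ 2 by ring.
  have -> : q ^+ 2 * (2 + g - g ^+ 2) - 3 * s * q + s ^+ 2 =
    s ^+ 2 + q ^+ 2 - 3 * s * q by rewrite gg; ring.
  by rewrite h; ring.
have f1 : q <= q * (1 + g) - s.
  have : 0 <= q * (g - 1) by rewrite mulr_ge0 ?(ltW q0)//; lra.
  lra.
have e0 : 0 < q * (2 - g) - s.
  by rewrite -(pmulr_lgt0 _ (lt_le_trans q0 f1)) e.
have e1 : (q * (2 - g) - s) * q <= 1 by rewrite -[leRHS]e ler_pM2l.
have -> : 2 - g - s / q = (q * (2 - g) - s) * q / q ^+ 2 by field; rewrite gt_eqF.
apply/andP; split; first by rewrite divr_ge0 ?exprn_ge0 ?mulr_ge0// ltW.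
by rewrite exprVn ler_piMl// invr_ge0 exprn_ge0// ltW.
Qed.

(** By [greedy_decomposition] an orbit segment splits into at most [2 * l]
    blocks whose lengths are denominators, each contributing at most 6. *)
Lemma sum_wave_golden l x j : (j <= den l)%N ->
  `|\sum_(k < j) wave (x + k%:R * (2 - golden R))| <= 12 * l%:R + 6.
Proof.
pose A n c := forall y, `|\sum_(k < n) wave (y + k%:R * (2 - golden R))| <= c.
rewrite leq_eqVlt => /predU1P[->|jl].
  apply: (le_trans (sum_wave_approximant x (approximant_golden l))).
  by have := ler0n R l; lra.
have [i [k [/[!ltnS] /[!leqn0] /eqP -> -> Ak]]] :
  exists i k, [/\ (i < den 0)%N, j = (k + i)%N & A k (\sum_(0 <= l < 0 + l) 2 * 6)].
  apply: (@greedy_decomposition R A (fun=> 6)); last by rewrite add0n.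
  - by move=> y; rewrite big_ord0 normr0.
  - move=> m n a b Am An y; rewrite big_split_ord/=.
    apply: (le_trans (ler_normD _ _)); apply: lerD; first exact: Am.
    apply: le_trans (An (y + m%:R * (2 - golden R))).
    rewrite le_eqVlt; apply/orP; left; apply/eqP; congr (`|_|).
    by apply: eq_bigr => k _; congr wave; rewrite natrD; ring.
  - by move=> n a b An ab y; apply: le_trans (An y) _.
  - by [].
  - by move=> i y; exact: sum_wave_approximant (approximant_golden i).
rewrite addn0; apply: (le_trans (Ak x)).
by rewrite sumr_const_nat add0n subn0 -[_ *+ l]mulr_natl; have := ler0n R l; lra.
Qed.

Lemma sum_zigzag_golden l x :
  `|\sum_(k < den l) zigzag (x + k%:R * (2 - golden R))| <= 13 * (l.+1%:R / 2 ^+ l).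
Proof.
apply: (@le_trans _ _ ((12 * l%:R + 6 + 7) / (den l)%:R)).
  apply: (sum_zigzag_approximant _ (approximant_golden l)) => y j.
  exact: sum_wave_golden.
have l0 := ler0n R l.
rewrite mulrA ler_pM ?invr_ge0//; first by lra.
by rewrite lef_pV2 ?posrE ?ltr0n ?den_gt0 ?exprn_gt0// -natrX ler_nat den_ge.
Qed.

Lemma den_golden l :
  0 <= (den l)%:R * (2 - golden R) - (num l)%:R <= l.+1%:R / 2 ^+ l.
Proof.
have [q0 _ /andP[d0 d1]] := approximant_golden l.
have q0' : 0 < (den l)%:R :> R by rewrite ltr0n.
have -> : (den l)%:R * (2 - golden R) - (num l)%:R =
  (den l)%:R * (2 - golden R - (num l)%:R / (den l)%:R) by field; rewrite gt_eqF.
rewrite mulr_ge0 ?(ltW q0')//=.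
apply: (@le_trans _ _ ((den l)%:R * (den l)%:R^-1 ^+ 2)).
  by rewrite ler_pM2l.
rewrite expr2 mulrA divff ?mul1r ?gt_eqF//.
apply: (@le_trans _ _ (2 ^+ l)^-1).
  by rewrite lef_pV2 ?posrE ?exprn_gt0// -natrX ler_nat den_ge.
by rewrite ler_peMl ?invr_ge0 ?exprn_ge0// ler1n.
Qed.

(** The terms telescope: [(l + 1) / 2 ^ l = a (l + 1) - a l] with
    [a l = - 2 (l + 2) / 2 ^ l].  An even starting index [2 m] gives
    [2 ^ (2 m) >= (m + 1) ^ 2], hence a remainder of at most [4 / (m + 1)]. *)
Lemma sum_tail_le (eps : R) : 0 < eps ->
  exists L, forall i, \sum_(L <= l < L + i) l.+1%:R / 2 ^+ l <= eps.
Proof.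
move=> eps0; pose m := Num.bound (4 / eps); exists m.*2 => i.
pose a l : R := - (l.+2%:R * 2 / 2 ^+ l).
rewrite (@GRing.telescope_sumr_eq _ _ _ a) ?leq_addr//; last first.
  move=> l _; rewrite /a exprS -!natr1; field.
  by rewrite expf_neq0.
have a0 l : a l <= 0 by rewrite oppr_le0 divr_ge0 ?exprn_ge0 ?mulr_ge0.
apply: (@le_trans _ _ (- a m.*2)); first by have := a0 (m.*2 + i)%N; lra.
rewrite /a opprK -muln2 exprM.
have m1 : m.+1%:R <= 2 ^+ m :> R by rewrite -natrX ler_nat ltn_expl.
have mp : 0 < m.+1%:R :> R by rewrite ltr0n.
apply: (@le_trans _ _ (4 * m.+1%:R / m.+1%:R ^+ 2)).
  apply: ler_pM; rewrite ?mulr_ge0 ?invr_ge0 ?exprn_ge0//.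
    by rewrite -!natr1 natrM; lra.
  by rewrite lef_pV2 ?posrE ?exprn_gt0// ler_pXn2r// ?nnegrE ?exprn_ge0// ltW.
have -> : 4 * m.+1%:R / m.+1%:R ^+ 2 = 4 / m.+1%:R :> R.
  by rewrite expr2 invfM mulrA mulfK// gt_eqF.
rewrite ler_pdivrMr// mulrC -ler_pdivrMr//.
have /ltW := archi_boundP (divr_ge0 (ler0n R 4) (ltW eps0)).
by move/le_trans; apply; rewrite ler_nat.
Qed.

End Golden.

(** * Complex numbers *)

Section ComplexNumbers.
Variable R : realType.
Implicit Types z : R[i].

Lemma complex_eq z1 z2 : complex.Re z1 = complex.Re z2 ->
  complex.Im z1 = complex.Im z2 -> z1 = z2.
Proof. by case: z1 z2 => [? ?] [? ?] /= -> ->. Qed.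

Lemma ReD z1 z2 : complex.Re (z1 + z2) = complex.Re z1 + complex.Re z2.
Proof. by case: z1 z2 => [? ?] []. Qed.

Lemma ImD z1 z2 : complex.Im (z1 + z2) = complex.Im z1 + complex.Im z2.
Proof. by case: z1 z2 => [? ?] []. Qed.

Lemma ReB z1 z2 : complex.Re (z1 - z2) = complex.Re z1 - complex.Re z2.
Proof. by case: z1 z2 => [? ?] []. Qed.

Lemma ImB z1 z2 : complex.Im (z1 - z2) = complex.Im z1 - complex.Im z2.
Proof. by case: z1 z2 => [? ?] []. Qed.

Lemma ReM z1 z2 : complex.Re (z1 * z2) =
  complex.Re z1 * complex.Re z2 - complex.Im z1 * complex.Im z2.
Proof. by case: z1; case: z2. Qed.

Lemma ImM z1 z2 : complex.Im (z1 * z2) =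
  complex.Re z1 * complex.Im z2 + complex.Im z1 * complex.Re z2.
Proof. by case: z1; case: z2. Qed.

Lemma ReZ (r : R) z : complex.Re (r%:C%C * z) = r * complex.Re z.
Proof. by rewrite ReM/= mul0r subr0. Qed.

Lemma conjcM z1 z2 : (z1 * z2)^*%C = z1^*%C * z2^*%C.
Proof. exact: rmorphM. Qed.

Lemma conjc_sum n (F : nat -> R[i]) :
  (\sum_(k < n) F k)^*%C = \sum_(k < n) (F k)^*%C.
Proof. exact: (rmorph_sum (@conjc R)). Qed.

Lemma normc_ge0 z : 0 <= normc z.
Proof. by case: z => a b; exact: sqrtr_ge0. Qed.

Lemma normc_sqr z : normc z ^+ 2 = complex.Re z ^+ 2 + complex.Im z ^+ 2.
Proof. by case: z => a b; rewrite /= sqr_sqrtr// addr_ge0 ?sqr_ge0. Qed.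

Lemma normc_sum (I : Type) (r : seq I) (F : I -> R[i]) :
  normc (\sum_(i <- r) F i) <= \sum_(i <- r) normc (F i).
Proof.
elim: r => [|i r IH]; first by rewrite !big_nil normc0.
by rewrite !big_cons; apply: (le_trans (le_normcD _ _)); rewrite lerD2l.
Qed.

Lemma normcD_sqr_le z1 z2 : normc (z1 + z2) ^+ 2 <= 2 * normc z1 ^+ 2 + 2 * normc z2 ^+ 2.
Proof.
rewrite !normc_sqr !raddfD/=.
by have := sqr_ge0 (complex.Re z1 - complex.Re z2);
  have := sqr_ge0 (complex.Im z1 - complex.Im z2); nra.
Qed.

Lemma normr_Re_le z : `|complex.Re z| <= 1 + normc z ^+ 2.
Proof.
rewrite normc_sqr -(real_normK (num_real (complex.Re z))).
by have := sqr_ge0 (complex.Im z); have := sqr_ge0 (`|complex.Re z| - 1); nra.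
Qed.

Lemma normr_Im_le z : `|complex.Im z| <= 1 + normc z ^+ 2.
Proof.
rewrite normc_sqr -(real_normK (num_real (complex.Im z))).
by have := sqr_ge0 (complex.Re z); have := sqr_ge0 (`|complex.Im z| - 1); nra.
Qed.

Lemma normc2_conj z : (normc z ^+ 2)%:C%C = z * z^*%C.
Proof. by apply: complex_eq; rewrite ?ReM ?ImM normc_sqr; case: z => a b /=; ring. Qed.

Lemma normc_Complex_le (a b M : R) : `|a| <= M -> `|b| <= M ->
  normc (Complex a b) <= 2 * M.
Proof.
move=> aM bM; have M0 : 0 <= M by apply: le_trans aM.
rewrite -(@ler_pXn2r _ 2) ?nnegrE ?normc_ge0 ?mulr_ge0// normc_sqr/=.
rewrite -(real_normK (num_real a)) -(real_normK (num_real b)).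
by have := normr_ge0 a; have := normr_ge0 b; nra.
Qed.

End ComplexNumbers.

(** * Characters and trigonometric polynomials *)

Section Expi.
Variable R : realType.
Implicit Types (x y t : R) (z : R[i]).

Lemma expi0 : expi 0 = 1 :> R[i].
Proof. by rewrite /expi cos0 sin0. Qed.

Lemma expiD x y : expi (x + y) = expi x * expi y.
Proof. by rewrite /expi cosD sinD; simpc; rewrite [cos x * sin y + _]addrC. Qed.

Lemma normc_expi x : normc (expi x) = 1.
Proof. by rewrite /= cos2Dsin2 sqrtr1. Qed.

Lemma conj_expi x : (expi x)^*%C = expi (- x).
Proof. by rewrite /expi cosN sinN. Qed.

Lemma expi_periodic : periodic (@expi R) (2 * pi).
Proof.
by move=> x; rewrite /expi mulr_natl sinD2pi cosD2pi.
Qed.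

Lemma expi2piz (m : int) : expi (m%:~R * (2 * pi)) = 1 :> R[i].
Proof.
have pos (n : nat) : expi (n%:R * (2 * pi)) = 1 :> R[i].
  by rewrite -[LHS]addr0 mulr_natl -[X in expi X]add0r (periodicn expi_periodic) expi0 addr0.
case: m => n; first exact: pos.
apply: (mulIf (x := expi (n.+1%:R * (2 * pi)))).
  by rewrite pos oner_neq0.
by rewrite -expiD NegzE mulrNz mulNr addNr expi0 pos mul1r.
Qed.

Lemma normr_sin_le x : `|sin x| <= `|x|.
Proof.
wlog x0 : x / 0 < x => [hw|].
  have [/hw//|xn|<-] := ltgtP 0 x; last by rewrite sin0 normr0.
  by rewrite -(normrN x) -(normrN (sin x)) -sinN hw// oppr_gt0.
have [c _] : exists2 c, c \in `]0, x[ & sin x - sin 0 = cos c * (x - 0).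
  apply: MVT => //.
  apply: (@continuous_subspaceT _ _ _ (@sin R)); exact: continuous_sin.
rewrite sin0 !subr0 => ->; rewrite normrM ler_piMl//; exact: cos_max.
Qed.

Lemma normc_expi1 x : normc (expi x - 1) <= `|x|.
Proof.
rewrite -(@ler_pXn2r _ 2) ?nnegrE ?normc_ge0// normc_sqr/= subr0.
rewrite real_normK ?num_real//.
have -> : (cos x - 1) ^+ 2 + sin x ^+ 2 = 2 - 2 * cos x by have := cos2Dsin2 x; nra.
pose y := x / 2; have -> : x = y *+ 2 by rewrite /y -mulr_natr; field.
rewrite cos_mulr2n -[y *+ 2]mulr_natl -[cos y ^+ 2 *+ 2]mulr_natl.
have sy : sin y ^+ 2 <= y ^+ 2.
  rewrite -[leLHS]real_normK ?num_real// -[leRHS]real_normK ?num_real//.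
  by rewrite ler_pXn2r ?nnegrE// normr_sin_le.
by have := cos2Dsin2 y; nra.
Qed.

Lemma expi_lip x y : normc (expi x - expi y) <= `|x - y|.
Proof.
have -> : expi x - expi y = expi y * (expi (x - y) - 1).
  by rewrite mulrBr mulr1 -expiD; congr (expi _ - _); ring.
by rewrite normcM normc_expi mul1r; exact: normc_expi1.
Qed.

(** Trigonometric polynomials of degree at most [n]; the coefficient of index
    [k] belongs to the frequency [k - n], as in [window_sum]. *)
Definition trigpoly n (a : nat -> R[i]) t : R[i] :=
  \sum_(k < n.*2.+1) a k * expi ((k%:Z - n%:Z)%:~R * t).

Lemma trigpoly_periodic n a : periodic (trigpoly n a) (2 * pi).
Proof.
by move=> t; apply: eq_bigr => k _; rewrite mulrDr expiD expi2piz mulr1.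
Qed.

Lemma trigpoly_bounded n a : exists2 B, 0 <= B & forall t, normc (trigpoly n a t) <= B.
Proof.
exists (\sum_(k < n.*2.+1) normc (a k)) => [|t].
  by apply: sumr_ge0 => k _; exact: normc_ge0.
apply: (le_trans (normc_sum _ _)); apply: ler_sum => k _.
by rewrite normcM normc_expi mulr1.
Qed.

Lemma trigpoly_lip n a : exists2 C, 0 <= C &
  forall x y, normc (trigpoly n a x - trigpoly n a y) <= C * `|x - y|.
Proof.
exists (\sum_(k < n.*2.+1) normc (a k) * `|(k%:Z - n%:Z)%:~R|) => [|x y].
  by apply: sumr_ge0 => k _; rewrite mulr_ge0 ?normc_ge0.
rewrite -sumrB mulr_suml; apply: (le_trans (normc_sum _ _)).
apply: ler_sum => k _; rewrite -mulrBr normcM -mulrA ler_wpM2l ?normc_ge0//.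
by apply: (le_trans (expi_lip _ _)); rewrite -mulrBr normrM.
Qed.

End Expi.

(** * Almost periodicity of the quantum map in the uniform norm *)

Section Iterates.
Variables (R : realType) (K hbar : R).
Implicit Types (f : R -> R[i]) (x y t : R).

Local Notation F := (Fmap K hbar).
Local Notation g := (golden R).

Lemma iter_Fmap n f t : iter n F f t =
  expi (- (K / hbar) * \sum_(k < n) tent (t - 2 * pi * g * k.+1%:R)) *
  f (t - 2 * pi * g * n%:R).
Proof.
elim: n t => [|n IH] t; first by rewrite big_ord0 !mulr0 subr0 expi0 mul1r.
rewrite iterS /Fmap IH big_ord_recl/= mulrA -expiD.
have -> : \sum_(k < n) tent (t - 2 * pi * g * (bump 0 k).+1%:R) =
    \sum_(k < n) tent (t - 2 * pi * g - 2 * pi * g * k.+1%:R).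
  by apply: eq_bigr => k _; congr tent; rewrite /bump/= add1n -[in LHS]natr1; ring.
congr (expi _ * f _); first by rewrite mulr1; ring.
by rewrite -natr1; ring.
Qed.

(** The phase depends on the point and the number of iterations only, so it
    drops out of differences: this one identity gives the isometry both in the
    uniform and in the L^2 sense. *)
Lemma iter_Fmap_dist n f1 f2 t : normc (iter n F f1 t - iter n F f2 t) =
  normc (f1 (t - 2 * pi * g * n%:R) - f2 (t - 2 * pi * g * n%:R)).
Proof. by rewrite !iter_Fmap -mulrBr normcM normc_expi mul1r. Qed.

(** Rotating by [- g] or by [2 - g] is the same on the circle; the latter is
    the angle that the denominators approximate from below. *)
Lemma sum_tent_golden n t : \sum_(k < n) tent (t - 2 * pi * g * k.+1%:R) =
  2 * pi * \sum_(k < n) zigzag (t / (2 * pi) - g + k%:R * (2 - g)).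
Proof.
rewrite mulr_sumr; apply: eq_bigr => k _; rewrite -zigzag_tent.
have pi0 : pi != 0 :> R by rewrite gt_eqF ?pi_gt0.
have -> : 2 * pi * (t / (2 * pi) - g + k%:R * (2 - g)) =
    t - 2 * pi * g * k.+1%:R + 2 * pi *+ (2 * k).
  rewrite -[_ *+ (2 * k)]mulr_natr natrM -[k.+1%:R]natr1.
  by move: (@pi R) pi0 => p p0; field.
by rewrite (periodicn (@tent_periodic R)).
Qed.

(** After [den l] steps the phase is small by [sum_zigzag_golden] and the
    rotation is nearly the identity by [den_golden]; both errors are measured
    by the same summable sequence. *)
Lemma Fmap_return n a : exists2 E, 0 <= E & forall l t,
  normc (iter (den l) F (trigpoly n a) t - trigpoly n a t) <= E * (l.+1%:R / 2 ^+ l).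
Proof.
have [B B0 PB] := trigpoly_bounded n a; have [C C0 PC] := trigpoly_lip n a.
have pi0 := pi_ge0 R.
set P := trigpoly n a in PB PC *.
exists (`|K / hbar| * (2 * pi) * 13 * B + C * (2 * pi)).
  by rewrite addr_ge0 ?mulr_ge0.
move=> l t; set r := l.+1%:R / 2 ^+ l.
have /andP[d0 d1] := den_golden R l; set d := _ - _ in d0 d1.
have sh : P (t - 2 * pi * g * (den l)%:R) = P (t + 2 * pi * d).
  pose m : int := (num l)%:Z - (2 * den l)%:Z.
  have -> : t - 2 * pi * g * (den l)%:R = t + 2 * pi * d + m%:~R * (2 * pi).
    by rewrite /d /m rmorphB/= -!pmulrn natrM; ring.
  by apply: eq_bigr => k _; rewrite mulrDr mulrA -intrM expiD expi2piz mulr1.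
rewrite iter_Fmap sh; set s := - _ * _.
have -> : expi s * P (t + 2 * pi * d) - P t =
  (expi s - 1) * P (t + 2 * pi * d) + (P (t + 2 * pi * d) - P t) by ring.
apply: (le_trans (le_normcD _ _)); rewrite normcM [leRHS]mulrDl; apply: lerD.
  rewrite [leRHS]mulrAC; apply: ler_pM; rewrite ?normc_ge0//.
  apply: (le_trans (normc_expi1 _)); rewrite /s sum_tent_golden.
  rewrite normrM normrN [X in _ * X]normrM [X in _ * (X * _)]ger0_norm ?mulr_ge0//.
  have -> : `|K / hbar| * (2 * pi) * 13 * r = `|K / hbar| * (2 * pi * (13 * r)) by ring.
  by rewrite !ler_wpM2l ?mulr_ge0// sum_zigzag_golden.
apply: (le_trans (PC _ _)); rewrite -[leRHS]mulrA; apply: ler_wpM2l => //.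
rewrite addrAC subrr add0r.
rewrite ger0_norm ?mulr_ge0//; apply: ler_wpM2l => //; exact: mulr_ge0.
Qed.

(** [greedy_decomposition] applied to the distance between [P] and its iterate:
    costs add because the iterates are isometries. *)
Lemma Fmap_almost_periodic n a (eps : R) : 0 < eps -> exists M : nat,
  forall m, exists2 j, (j < M)%N & forall t,
    normc (iter m F (trigpoly n a) t - iter j F (trigpoly n a) t) <= eps.
Proof.
move=> eps0; have [E E0 PE] := Fmap_return n a; set P := trigpoly n a in PE *.
have e2 : 0 < eps / (2 * (E + 1)) by rewrite divr_gt0// mulr_gt0// ltr_wpDl.
have [L hL] := sum_tail_le e2; exists (den L) => m.
pose A k c := forall t, normc (iter k F P t - P t) <= c.
have mi : (m < den (L + m))%N.
  apply: leq_trans (den_ge _).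
  by apply: leq_trans (ltn_expl m (ltnSn 1)) _; rewrite leq_pexp2l// leq_addl.
have [j [k [jL -> Ak]]] : exists j k, [/\ (j < den L)%N, m = (k + j)%N &
    A k (\sum_(L <= l < L + m) 2 * (E * (l.+1%:R / 2 ^+ l)))].
  apply: greedy_decomposition mi => //.
  - by move=> t; rewrite subrr normc0.
  - move=> p q b c Ap Aq t.
    have -> : iter (p + q) F P t - P t =
      (iter p F (iter q F P) t - iter p F P t) + (iter p F P t - P t).
      by rewrite iterD; ring.
    rewrite addrC; apply: (le_trans (le_normcD _ _)); apply: lerD; first exact: Ap.
    by rewrite iter_Fmap_dist.
  - by move=> p b c Ap bc t; apply: le_trans (Ap t) bc.
  - by move=> l; rewrite mulr_ge0// divr_ge0// exprn_ge0.
exists j => // t; rewrite addnC iterD iter_Fmap_dist; apply: (le_trans (Ak _)).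
rewrite -mulr_sumr -mulr_sumr mulrA.
apply: (le_trans (ler_wpM2l _ (hL _))); first by rewrite mulr_ge0.
have E1 : 0 < E + 1 by lra.
by rewrite mulrA ler_pdivrMr ?mulr_gt0//; nra.
Qed.

End Iterates.

(** * Translation invariance of integrals of periodic functions *)

Section Shift.
Context {R : realType}.
Local Notation mu := (@lebesgue_measure R).

(** Naming the translation lets its measurability be registered, so that the
    push-forward below is recognized as a measure. *)
Definition translate (c : R) : measurableTypeR R -> measurableTypeR R :=
  fun x => x + c.

Lemma measurable_translate c : measurable_fun [set: measurableTypeR R] (translate c).
Proof. by apply: measurable_funD. Qed.

HB.instance Definition _ c :=
  isMeasurableFun.Build _ _ _ _ (translate c) (measurable_translate c).

Lemma lebesgue_measure_translate (c : R) (A : set R) : measurable A ->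
  pushforward mu (translate c) A = mu A.
Proof.
move=> mA; apply/esym/lebesgue_measure_unique => //= _ [[a b]] _ <-.
rewrite /pushforward.
have -> : translate c @^-1` [set` `]a, b]] = [set` `]a - c, b - c]].
  by apply/seteqP; split => x /=; rewrite /translate !in_itv/= ltrBlDr lerBrDr.
rewrite !lebesgue_measure_itv/= !lte_fin ltrD2r.
by case: ifP => // _; rewrite -!EFinB; congr (_%:E); ring.
Qed.

Lemma ge0_integral_translate (f : R -> \bar R) (A : set R) (c : R) :
  measurable A -> measurable_fun [set: R] f -> (forall x, 0 <= f x)%E ->
  (\int[mu]_(x in A) f x = \int[mu]_(x in translate c @^-1` A) f (x + c)%R)%E.
Proof.
move=> mA mf f0.
transitivity (\int[pushforward mu (translate c)]_(x in A) f x)%E.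
  by apply: eq_measure_integral => //= B mB BA; exact/esym/lebesgue_measure_translate.
rewrite (ge0_integral_pushforward (measurable_translate c))//.
exact: measurable_funS mf.
Qed.

(** Reduce the shift modulo the period to [a] in [0, T[, cut the translated
    period at [T], and bring the overhanging part [T, a + T[ back to [0, a[. *)
Lemma ge0_integral_period (f : R -> \bar R) (T c : R) : 0 < T ->
  (forall x, f (x + T) = f x)%R -> measurable_fun [set: R] f -> (forall x, 0 <= f x)%E ->
  (\int[mu]_(x in `[0%R, T]) f (x - c)%R = \int[mu]_(x in `[0%R, T]) f x)%E.
Proof.
move=> T0 fT mf f0.
have fz x (m : int) : f (x + m%:~R * T) = f x.
  have fn n y : f (y + n%:R * T) = f y.
    elim: n => [|n IH]; first by rewrite mul0r addr0.
    by rewrite -natr1 mulrDl mul1r addrA fT.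
  case: m => n; first exact: fn.
  rewrite -[LHS](fn n.+1); congr f; rewrite NegzE mulrNz -pmulrn; ring.
have mfS B : measurable_fun B f by exact: measurable_funS mf.
pose a := - c - (Num.floor (- c / T))%:~R * T.
have /andP[a0 aT] : 0 <= a < T.
  have /andP[] := floor_itv (- c / T); rewrite rmorphD/= mulr1z.
  rewrite ler_pdivlMr// ltr_pdivrMr// /a => h1 h2.
  by apply/andP; split; lra.
have fa x : f (x - c) = f (x + a).
  by rewrite -[RHS](fz _ (Num.floor (- c / T))) /a; congr f; ring.
under eq_integral do rewrite fa.
have mfa : measurable_fun [set: R] (fun x => f (x + a)).
  by apply: measurableT_comp => //; exact: measurable_translate.
rewrite -integral_itv_bndo_bndc; last exact: measurable_funS mfa.
rewrite -[RHS]integral_itv_bndo_bndc//.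
have -> : (\int[mu]_(x in `[0%R, T[) f (x + a)%R = \int[mu]_(x in `[a, (a + T)%R[) f x)%E.
  rewrite [RHS](@ge0_integral_translate _ _ a)//; congr (integral _ _ _).
  apply/seteqP; split => x /=; rewrite /translate !in_itv/= => /andP[? ?];
    by apply/andP; split; lra.
have itvU (x y z : R) : x <= y -> y <= z -> `[x, z[%classic = `[x, y[ `|` `[y, z[.
  move=> xy yz; apply/seteqP; split => t /=; rewrite !in_itv/=.
    by case: (ltP t y) => ty /andP[xt tz]; [left|right]; apply/andP.
  by case=> /andP[h1 h2]; apply/andP; split; lra.
have disj (x y z : R) : [disjoint `[x, y[ & `[y, z[].
  apply/disj_setPS => t [] /=; rewrite !in_itv/= => /andP[_ h1] /andP[h2 _]; lra.
rewrite (itvU a T) ?(ltW aT)//; last by rewrite lerDr.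
rewrite (itvU 0 a T) ?(ltW aT)//.
have intU (A B : set R) : measurable A -> measurable B -> [disjoint A & B] ->
    (\int[mu]_(x in A `|` B) f x = \int[mu]_(x in A) f x + \int[mu]_(x in B) f x)%E.
  by move=> mA mB AB; rewrite ge0_integral_setU//; exact: mfS.
rewrite !intU//; try exact: disj.
rewrite addeC; congr (_ + _)%E.
rewrite [LHS](@ge0_integral_translate _ _ T)//.
under eq_integral do rewrite fT.
congr (integral _ _ _).
by apply/seteqP; split => x /=; rewrite /translate !in_itv/= => /andP[? ?]; apply/andP; split; lra.
Qed.

End Shift.

(** * Square-integrable periodic functions *)

Section SquareIntegrable.
Variable R : realType.
Implicit Types (f g : R -> R[i]) (x y t c : R) (z : R[i]).
Local Notation mu := (@lebesgue_measure R).
Local Notation I := (`[0, 2 * pi]%classic : set R).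

Let pi0 : 0 < pi :> R := pi_gt0 R.

Lemma measurable_period : measurable I. Proof. exact: measurable_itv. Qed.

Lemma lebesgue_measure_period : mu I = (2 * pi)%:E.
Proof. by rewrite lebesgue_measure_itv/= lte_fin mulr_gt0// sube0. Qed.

Lemma lebesgue_measure_period_lty : (mu I < +oo)%E.
Proof. by rewrite lebesgue_measure_period ltry. Qed.

Lemma Rintegral_period_cst (r : R) : \int[mu]_(t in I) r = 2 * pi * r.
Proof.
rewrite (Rintegral_cst mu measurable_period) [RHS]mulrC; congr (_ * _).
exact: (congr1 fine lebesgue_measure_period).
Qed.

Lemma bounded_integrable_period (h : R -> R) (M : R) : measurable_fun [set: R] h ->
  (forall t, `|h t| <= M) -> mu.-integrable I (EFin \o h).
Proof.
move=> mh hM; apply: (@measurable_bounded_integrable _ _ R mu h I measurable_period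
  lebesgue_measure_period_lty).
- exact: measurable_funTS.
- by exists M; split; rewrite ?num_real// => x Mx t _ /=; rewrite (le_trans (hM t))// ltW.
Qed.

Lemma dominated_integrable_period (h k : R -> R) : measurable_fun [set: R] h ->
  (forall t, `|h t| <= k t) -> mu.-integrable I (EFin \o k) ->
  mu.-integrable I (EFin \o h).
Proof.
move=> mh hk; apply: le_integrable; first exact: measurable_period.
  by apply/measurable_EFinP; exact: measurable_funTS.
move=> t _ /=; rewrite lee_fin (le_trans (hk t))// ler_norm.
by [].
Qed.

Lemma integrable_periodD (h k : R -> R) : mu.-integrable I (EFin \o h) ->
  mu.-integrable I (EFin \o k) -> mu.-integrable I (EFin \o (fun t => h t + k t)).
Proof. exact: (@integrableD _ _ R mu I measurable_period). Qed.

Lemma integrable_periodZ (h : R -> R) (r : R) : mu.-integrable I (EFin \o h) ->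
  mu.-integrable I (EFin \o (fun t => r * h t)).
Proof. exact: (@integrableZl _ _ R mu I measurable_period r). Qed.

Lemma Rintegral_periodD (h k : R -> R) : mu.-integrable I (EFin \o h) ->
  mu.-integrable I (EFin \o k) ->
  \int[mu]_(t in I) (h t + k t) = \int[mu]_(t in I) h t + \int[mu]_(t in I) k t.
Proof. exact: (@RintegralD _ _ R mu I _ _ measurable_period). Qed.

Lemma Rintegral_periodZ (h : R -> R) (r : R) : mu.-integrable I (EFin \o h) ->
  \int[mu]_(t in I) (r * h t) = r * \int[mu]_(t in I) h t.
Proof. exact: (@RintegralZl _ _ R mu I _ r measurable_period). Qed.

Definition cmeasurable f := measurable_fun [set: R] (fun t => complex.Re (f t)) /\
  measurable_fun [set: R] (fun t => complex.Im (f t)).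

Lemma cmeasurable_add f g : cmeasurable f -> cmeasurable g -> cmeasurable (fun t => f t + g t).
Proof.
move=> [f1 f2] [g1 g2]; split.
  by under eq_fun do rewrite raddfD/=; exact: measurable_funD.
by under eq_fun do rewrite raddfD/=; exact: measurable_funD.
Qed.

Lemma cmeasurable_mul f g : cmeasurable f -> cmeasurable g -> cmeasurable (fun t => f t * g t).
Proof.
move=> [f1 f2] [g1 g2]; split.
  by under eq_fun do rewrite ReM; apply: measurable_funB; exact: measurable_funM.
by under eq_fun do rewrite ImM; apply: measurable_funD; exact: measurable_funM.
Qed.

Lemma cmeasurable_cst z : cmeasurable (fun=> z).
Proof. by split; exact: measurable_cst. Qed.

Lemma cmeasurable_sum (n : nat) (F : nat -> R -> R[i]) : (forall k, cmeasurable (F k)) ->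
  cmeasurable (fun t => \sum_(k < n) F k t).
Proof.
move=> mF; elim: n => [|n IH].
  by under eq_fun do rewrite big_ord0; exact: cmeasurable_cst.
by under eq_fun do rewrite big_ord_recr/=; exact: cmeasurable_add.
Qed.

Lemma cmeasurable_expi (h : R -> R) : measurable_fun [set: R] h ->
  cmeasurable (fun t => expi (h t)).
Proof.
move=> mh; split => /=.
  by apply: measurableT_comp => //; apply: continuous_measurable_fun; exact: continuous_cos.
by apply: measurableT_comp => //; apply: continuous_measurable_fun; exact: continuous_sin.
Qed.

Lemma cmeasurable_shift f c : cmeasurable f -> cmeasurable (fun t => f (t - c)).
Proof.
have ms := measurable_translate (- c).
by move=> [f1 f2]; split;
  [exact: (measurableT_comp f1 ms)|exact: (measurableT_comp f2 ms)].
Qed.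

Lemma cmeasurable_trigpoly n a : cmeasurable (@trigpoly R n a).
Proof.
apply: (cmeasurable_sum _ (F := fun k t => a k * expi ((k%:Z - n%:Z)%:~R * t))) => k.
apply: cmeasurable_mul; first exact: cmeasurable_cst.
by apply: cmeasurable_expi; apply: measurable_funM.
Qed.

Lemma measurable_normc2 f : cmeasurable f ->
  measurable_fun [set: R] (fun t => normc (f t) ^+ 2).
Proof.
move=> [f1 f2]; under eq_fun do rewrite normc_sqr.
by apply: measurable_funD; exact: measurable_funX.
Qed.

Lemma measurable_tent : measurable_fun [set: R] (@tent R).
Proof.
have -> : @tent R = fun t => 2 * pi * zigzag (t / (2 * pi)).
  by apply/funext => t; rewrite -zigzag_tent mulrC divfK// mulf_neq0// gt_eqF.
apply: measurable_funM => //; apply: measurableT_comp; last exact: measurable_funM.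
by apply: continuous_measurable_fun; exact: continuous_zigzag.
Qed.

Lemma L2perP f : L2per f <-> [/\ periodic f (2 * pi), cmeasurable f &
  mu.-integrable I (EFin \o (fun t => normc (f t) ^+ 2))].
Proof. by split=> [[? ? ? ?]|[? [? ?] ?]]; split. Qed.

Lemma L2per_add f g : L2per f -> L2per g -> L2per (fun t => f t + g t).
Proof.
move=> /L2perP[fp mf fi] /L2perP[gp mg gi]; apply/L2perP; split.
- by move=> t; rewrite fp gp.
- exact: cmeasurable_add.
- apply: (@dominated_integrable_period _
    (fun t => 2 * normc (f t) ^+ 2 + 2 * normc (g t) ^+ 2)).
  + exact: (measurable_normc2 (cmeasurable_add mf mg)).
  + by move=> t; rewrite ger0_norm ?sqr_ge0// normcD_sqr_le.
  + by apply: integrable_periodD; exact: integrable_periodZ.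
Qed.

Lemma L2per_mul f g (M : R) : periodic g (2 * pi) -> cmeasurable g ->
  (forall t, normc (g t) <= M) -> L2per f -> L2per (fun t => g t * f t).
Proof.
move=> gp mg gM /L2perP[fp mf fi]; apply/L2perP; split.
- by move=> t; rewrite fp gp.
- exact: cmeasurable_mul.
- apply: (@dominated_integrable_period _ (fun t => M ^+ 2 * normc (f t) ^+ 2)).
  + exact: (measurable_normc2 (cmeasurable_mul mg mf)).
  + move=> t; rewrite ger0_norm ?sqr_ge0// normcM exprMn ler_wpM2r ?sqr_ge0//.
    by rewrite ler_pXn2r ?nnegrE ?normc_ge0// (le_trans _ (gM t)) ?normc_ge0.
  + exact: integrable_periodZ.
Qed.

Lemma L2per_cst z : L2per (fun=> z).
Proof.
apply/L2perP; split; [by []|exact: cmeasurable_cst|].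
by apply: (@bounded_integrable_period _ (normc z ^+ 2)) => // t; rewrite ger0_norm// sqr_ge0.
Qed.

Lemma L2per_sub f g : L2per f -> L2per g -> L2per (fun t => f t - g t).
Proof.
move=> fL gL; have : L2per (fun t => - (1 : R[i]) * g t).
  apply: (@L2per_mul g (fun=> - (1 : R[i])) 1 _ _ _ gL).
  - by [].
  - exact: cmeasurable_cst.
  - by move=> t; rewrite normcN normc1.
move=> /(L2per_add fL); congr L2per; apply/funext => t; by rewrite mulN1r.
Qed.

Lemma L2per_trigpoly n a : L2per (@trigpoly R n a).
Proof.
have [B B0 PB] := trigpoly_bounded n a.
have := L2per_mul (trigpoly_periodic n a) (cmeasurable_trigpoly n a) PB (L2per_cst 1).
by congr L2per; apply/funext => t; rewrite mulr1.
Qed.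

Lemma ge0_Rintegral_period (h : R -> R) c : periodic h (2 * pi) ->
  measurable_fun [set: R] h -> (forall t, 0 <= h t) ->
  \int[mu]_(t in I) h (t - c) = \int[mu]_(t in I) h t.
Proof.
move=> hp mh h0; rewrite /Rintegral; congr fine.
apply: (@ge0_integral_period _ (EFin \o h)) => //.
- by rewrite mulr_gt0.
- by move=> x /=; rewrite hp.
- exact/measurable_EFinP.
Qed.

Lemma L2per_shift f c : L2per f -> L2per (fun t => f (t - c)).
Proof.
move=> /L2perP[fp mf fi]; apply/L2perP; split.
- by move=> t; rewrite addrAC fp.
- exact: cmeasurable_shift.
- have m2 := measurable_normc2 mf.
  apply/integrableP; split.
    by apply/measurable_EFinP/measurable_funTS; exact: (measurable_normc2 (cmeasurable_shift c mf)).
  move/integrableP : fi => [_]; apply: le_lt_trans; rewrite le_eqVlt; apply/orP; left; apply/eqP.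
  apply: (@ge0_integral_period _ (fun t => `|(normc (f t) ^+ 2)%:E|)%E) => //.
  + by rewrite mulr_gt0.
  + by move=> x; rewrite fp.
  + by apply: measurableT_comp => //; exact/measurable_EFinP.
Qed.

Lemma L2per_Fmap K hbar f : L2per f -> L2per (Fmap K hbar f).
Proof.
move=> fL; apply: (@L2per_mul (fun t => f (t - 2 * pi * golden R))
  (fun t => expi (- (K / hbar * tent (t - 2 * pi * golden R)))) 1).
- by move=> t; rewrite addrAC tent_periodic.
- apply: cmeasurable_expi; apply: measurableT_comp => //; apply: measurable_funM => //.
  apply: measurableT_comp; first exact: measurable_tent.
  exact: (measurable_translate (- _)).
- by move=> t; rewrite normc_expi.
- exact: L2per_shift.
Qed.

Lemma L2per_iter K hbar f n : L2per f -> L2per (iter n (Fmap K hbar) f).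
Proof. by move=> fL; elim: n => //= n; exact: L2per_Fmap. Qed.

(** [2 * pi] times the square of the normalized L^2 norm. *)
Definition energy f : R := \int[mu]_(t in I) normc (f t) ^+ 2.

Lemma energy_iter K hbar n f g : L2per f -> L2per g ->
  energy (fun t => iter n (Fmap K hbar) f t - iter n (Fmap K hbar) g t) =
  energy (fun t => f t - g t).
Proof.
move=> fL gL; have /L2perP[dp md _] := L2per_sub fL gL.
rewrite /energy; under eq_Rintegral do rewrite iter_Fmap_dist.
apply: (@ge0_Rintegral_period (fun t => normc (f t - g t) ^+ 2)).
- by move=> t; rewrite dp.
- exact: measurable_normc2.
- by move=> t; exact: sqr_ge0.
Qed.

End SquareIntegrable.

(** * Fourier coefficients and best approximation *)

Section Bessel.
Variable R : realType.
Implicit Types (f g : R -> R[i]) (x y t c : R) (z : R[i]).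
Local Notation mu := (@lebesgue_measure R).
Local Notation I := (`[0, 2 * pi]%classic : set R).

Definition Cintegrable f := mu.-integrable I (EFin \o (fun t => complex.Re (f t))) /\
  mu.-integrable I (EFin \o (fun t => complex.Im (f t))).

Lemma integralC_add f g : Cintegrable f -> Cintegrable g ->
  Cintegrable (fun t => f t + g t) /\
  integralC (fun t => f t + g t) = integralC f + integralC g.
Proof.
move=> [f1 f2] [g1 g2]; split.
  split; under [X in EFin \o X]eq_fun do rewrite ?ReD ?ImD; exact: integrable_periodD.
apply: complex_eq; rewrite ?ReD ?ImD /=.
  under eq_Rintegral do rewrite ReD.
  exact: Rintegral_periodD.
under eq_Rintegral do rewrite ImD.
exact: Rintegral_periodD.
Qed.

Lemma integralC_scale z f : Cintegrable f ->
  Cintegrable (fun t => z * f t) /\ integralC (fun t => z * f t) = z * integralC f.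
Proof.
move=> [f1 f2].
have i1 := integrable_periodZ (complex.Re z) f1; have i2 := integrable_periodZ (- complex.Im z) f2.
have i3 := integrable_periodZ (complex.Re z) f2; have i4 := integrable_periodZ (complex.Im z) f1.
have e1 t : complex.Re (z * f t) =
  complex.Re z * complex.Re (f t) + - complex.Im z * complex.Im (f t).
  by rewrite ReM mulNr.
have e2 t : complex.Im (z * f t) =
  complex.Re z * complex.Im (f t) + complex.Im z * complex.Re (f t) by rewrite ImM.
split.
  by split; [under [X in EFin \o X]eq_fun do rewrite e1|
    under [X in EFin \o X]eq_fun do rewrite e2]; exact: integrable_periodD.
apply: complex_eq; rewrite ?ReM ?ImM /=.
  by under eq_Rintegral do rewrite e1; rewrite Rintegral_periodD// !Rintegral_periodZ// mulNr.
by under eq_Rintegral do rewrite e2; rewrite Rintegral_periodD// !Rintegral_periodZ.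
Qed.

Lemma integralC_sum n (F : nat -> R -> R[i]) : (forall k, Cintegrable (F k)) ->
  Cintegrable (fun t => \sum_(k < n) F k t) /\
  integralC (fun t => \sum_(k < n) F k t) = \sum_(k < n) integralC (F k).
Proof.
move=> iF; elim: n => [|n [IH1 IH2]].
  have e : (fun t => \sum_(k < 0) F k t) = (fun t => 0 * F 0%N t).
    by apply/funext => t; rewrite big_ord0 mul0r.
  by rewrite e big_ord0 -[X in _ = X](mul0r (integralC (F 0%N))); exact: integralC_scale.
have e : (fun t => \sum_(k < n.+1) F k t) = (fun t => \sum_(k < n) F k t + F n t).
  by apply/funext => t; rewrite big_ord_recr.
by rewrite e big_ord_recr/= -IH2; exact: integralC_add.
Qed.

Lemma Cintegrable_L2per f : L2per f -> Cintegrable f.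
Proof.
move=> /L2perP[_ [f1 f2] fi].
have dom : mu.-integrable I (EFin \o (fun t => 1 + normc (f t) ^+ 2)).
  apply: integrable_periodD => //.
  by apply: (@bounded_integrable_period _ (fun=> 1) 1) => // t; rewrite normr1.
split.
  by apply: (dominated_integrable_period _ _ dom) => // t; exact: normr_Re_le.
by apply: (dominated_integrable_period _ _ dom) => // t; exact: normr_Im_le.
Qed.

Lemma L2per_character m : L2per (fun t : R => expi (m%:~R * t)).
Proof.
have p1 : periodic (fun t : R => expi (m%:~R * t)) (2 * pi).
  by move=> t; rewrite mulrDr expiD expi2piz mulr1.
have c1 : cmeasurable (fun t : R => expi (m%:~R * t)).
  by apply: cmeasurable_expi; apply: measurable_funM.
rewrite (_ : (fun t => _) = fun t => expi (m%:~R * t) * 1); last first.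
  by apply/funext => t; rewrite mulr1.
apply: (@L2per_mul _ (fun=> 1) _ 1 p1 c1); last exact: L2per_cst.
by move=> t; rewrite normc_expi.
Qed.

Lemma L2per_mul_character m f : L2per f -> L2per (fun t => f t * expi (m%:~R * t)).
Proof.
have /L2perP[p1 c1 _] := L2per_character m.
move=> fL; rewrite (_ : (fun t => _) = fun t => expi (m%:~R * t) * f t); last first.
  by apply/funext => t; rewrite mulrC.
by apply: (@L2per_mul _ f _ 1 p1 c1) => // t; rewrite normc_expi.
Qed.

(** A shift by half a period [pi / m] changes the sign of the cosine but not
    its integral over a period.  Adding 1 keeps the integrand nonnegative, as
    the invariance of [ge0_Rintegral_period] requires. *)
Lemma integral_cos_shift m (c : R) : m != 0 ->
  \int[mu]_(t in I) cos (m%:~R * t - c) = 0.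
Proof.
move=> m0; have mR : m%:~R != 0 :> R by rewrite intr_eq0.
pose h t : R := 1 + cos (m%:~R * t).
have hp : periodic h (2 * pi).
  by have /L2perP[p _ _] := L2per_character m; move=> t; have [/= e _] := p t; rewrite /h e.
have mh : measurable_fun [set: R] h.
  apply: measurable_funD => //; apply: measurableT_comp.
    by apply: continuous_measurable_fun; exact: continuous_cos.
  by apply: measurable_funM.
have h0 t : 0 <= h t by rewrite /h; have := cos_geN1 (m%:~R * t); lra.
have hs (d : R) : \int[mu]_(t in I) (1 + cos (m%:~R * t - d)) = \int[mu]_(t in I) h t.
  rewrite -(ge0_Rintegral_period (d / m%:~R) hp mh h0).
  by apply: eq_Rintegral => t _; rewrite /h mulrBr (mulrC _ (d / _)) divfK.
have ic (d : R) : mu.-integrable I (EFin \o (fun t => cos (m%:~R * t - d))).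
  apply: (@bounded_integrable_period _ _ 1) => [|t]; last exact: cos_max.
  apply: measurableT_comp; first by apply: continuous_measurable_fun; exact: continuous_cos.
  by apply: measurable_funB => //; apply: measurable_funM.
have i1 : mu.-integrable I (EFin \o (fun=> 1 : R)).
  by apply: (@bounded_integrable_period _ _ 1) => // t; rewrite normr1.
have J (d : R) : \int[mu]_(t in I) cos (m%:~R * t - d) = \int[mu]_(t in I) h t - 2 * pi.
  rewrite -(hs d) (Rintegral_periodD i1 (ic d)) Rintegral_period_cst; ring.
have Jc := J (c + pi); rewrite -(J c) in Jc.
have aux (X Y : R) : X = Y -> X = - Y -> Y = 0 by move=> -> ?; lra.
apply: (aux _ _ Jc).
rewrite -[RHS]mulN1r; apply: etrans _ (Rintegral_periodZ (-1) (ic c)).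
apply: eq_Rintegral => t _; rewrite mulN1r -[in RHS]cosN -[in LHS]cosN -cosDpi.
by congr cos; ring.
Qed.

(** The sine is the cosine shifted by [pi / 2], so one vanishing integral
    serves for both parts. *)
Lemma integralC_character m :
  integralC (fun t : R => expi (m%:~R * t)) = if m == 0 then (2 * pi)%:C%C else 0.
Proof.
case: eqVneq => [->|m0].
  have -> : (fun t : R => expi (0%:~R * t)) = (fun=> 1).
    by apply/funext => t; rewrite mul0r expi0.
  by apply: complex_eq => /=; rewrite Rintegral_period_cst ?mulr1 ?mulr0.
apply: complex_eq => /=.
  apply: etrans _ (integral_cos_shift 0 m0).
  by apply: eq_Rintegral => t _; rewrite subr0.
apply: etrans _ (integral_cos_shift (pi / 2) m0).
by apply: eq_Rintegral => t _; rewrite cosBpihalf.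
Qed.

Lemma inner_trigpoly f n a : L2per f ->
  integralC (fun t => f t * (trigpoly n a t)^*%C) =
  (2 * pi)%:C%C * \sum_(k < n.*2.+1) (a k)^*%C * fourier_coef f (k%:Z - n%:Z).
Proof.
move=> fL.
pose F (k : nat) t := (a k)^*%C * (f t * expi (- ((k%:Z - n%:Z)%:~R * t))).
have iF k : Cintegrable (fun t => f t * expi (- ((k%:Z - n%:Z)%:~R * t))).
  apply: Cintegrable_L2per; have := L2per_mul_character (- (k%:Z - n%:Z)) fL.
  by under [X in L2per X -> _]eq_fun do rewrite mulrNz mulNr.
have -> : (fun t => f t * (trigpoly n a t)^*%C) = (fun t => \sum_(k < n.*2.+1) F k t).
  apply/funext => t; rewrite /trigpoly (conjc_sum _ (fun k => a k * expi ((k%:Z - n%:Z)%:~R * t))).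
  rewrite mulr_sumr; apply: eq_bigr => k _.
  by rewrite conjcM conj_expi /F; ring.
have [_ ->] := integralC_sum n.*2.+1 (fun k => (integralC_scale (a k)^*%C (iF k)).1).
rewrite mulr_sumr; apply: eq_bigr => k _.
rewrite (integralC_scale (a k)^*%C (iF k)).2 /fourier_coef mulrCA; congr (_ * _).
rewrite mulrA -rmorphM/= divff ?rmorph1 ?mul1r//.
by rewrite mulf_neq0// gt_eqF// pi_gt0.
Qed.

Lemma fourier_coef_trigpoly n a (k : nat) : (k < n.*2.+1)%N ->
  fourier_coef (trigpoly n a) (k%:Z - n%:Z) = a k :> R[i].
Proof.
move=> kn.
have iF (j : nat) : Cintegrable (fun t : R => expi ((j%:Z - k%:Z)%:~R * t)).
  exact/Cintegrable_L2per/L2per_character.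
have e : (fun t => trigpoly n a t * expi (- ((k%:Z - n%:Z)%:~R * t))) =
    (fun t => \sum_(j < n.*2.+1) a j * expi ((j%:Z - k%:Z)%:~R * t)).
  apply/funext => t; rewrite mulr_suml; apply: eq_bigr => j _.
  by rewrite -mulrA -expiD; congr (_ * expi _); rewrite !rmorphB/=; ring.
rewrite /fourier_coef e.
have [_ ->] := integralC_sum n.*2.+1 (fun j => (integralC_scale (a j) (iF j)).1).
rewrite (bigD1 (Ordinal kn))//= big1 ?addr0 => [|j jk].
  rewrite (integralC_scale (a k) (iF k)).2 subrr integralC_character eqxx.
  rewrite mulrCA -rmorphM/= mulVf ?rmorph1 ?mulr1//.
  by rewrite mulf_neq0// gt_eqF// pi_gt0.
rewrite (integralC_scale (a j) (iF j)).2 integralC_character ifN ?mulr0//.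
by rewrite subr_eq0 eqz_nat.
Qed.

Lemma energy_inner f : energy f = complex.Re (integralC (fun t => f t * (f t)^*%C)).
Proof.
by rewrite /energy/=; apply: eq_Rintegral => t _; rewrite -normc2_conj.
Qed.

(** Expanding the square, [energy (f - P)] is [energy f] plus [2 * pi] times
    the sum of [|a k - c k| ^ 2 - |c k| ^ 2], where the [c k] are the Fourier
    coefficients of [f]; the first squares may be dropped. *)
Lemma best_approximation f n a : L2per f ->
  energy f - energy (fun t => f t - trigpoly n a t) <=
  2 * pi * \sum_(k < n.*2.+1) normc (fourier_coef f (k%:Z - n%:Z)) ^+ 2.
Proof.
move=> fL; set P := trigpoly n a; have PL : L2per P := L2per_trigpoly n a.
have iE (g : R -> R[i]) : L2per g -> mu.-integrable I (EFin \o (fun t => normc (g t) ^+ 2)).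
  by case/L2perP.
have iX : mu.-integrable I (EFin \o (fun t => complex.Re (f t * (P t)^*%C))).
  apply: (@dominated_integrable_period _ _ (fun t => normc (f t) ^+ 2 + normc (P t) ^+ 2)).
  - have /L2perP[_ [f1 f2] _] := fL; have /L2perP[_ [P1 P2] _] := PL.
    under eq_fun do rewrite ReM.
    have eR t : complex.Re (P t)^*%C = complex.Re (P t) by case: (P t).
    have eI t : complex.Im (P t)^*%C = - complex.Im (P t) by case: (P t).
    under eq_fun do rewrite eR eI mulrN opprK.
    by apply: measurable_funD; exact: measurable_funM.
  - move=> t; rewrite !normc_sqr; case: (f t) (P t) => [x y] [v w] /=.
    have := sqr_ge0 (x - v); have := sqr_ge0 (y - w); have := sqr_ge0 (x + v).
    have := sqr_ge0 (y + w); have := sqr_ge0 x; have := sqr_ge0 y.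
    have := sqr_ge0 v; have := sqr_ge0 w.
    by rewrite ler_norml => *; apply/andP; split; nra.
  - by apply: integrable_periodD; exact: iE.
have E : energy (fun t => f t - P t) = energy f + energy P +
    (- 2) * complex.Re (integralC (fun t => f t * (P t)^*%C)).
  rewrite /energy/= -(Rintegral_periodZ (- 2) iX).
  rewrite -(Rintegral_periodD (iE _ fL) (iE _ PL)) -Rintegral_periodD.
  - apply: eq_Rintegral => t _; rewrite !normc_sqr.
    by case: (f t) (P t) => [x y] [v w] /=; ring.
  - by apply: integrable_periodD; exact: iE.
  - exact: integrable_periodZ.
have EP : energy P = 2 * pi * \sum_(k < n.*2.+1) normc (a k) ^+ 2.
  rewrite energy_inner inner_trigpoly// ReZ; congr (_ * _).
  rewrite (raddf_sum (@complex.Re R : Rcomplex R -> R)); apply: eq_bigr => k _.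
  by rewrite fourier_coef_trigpoly// mulrC -normc2_conj.
rewrite E EP inner_trigpoly// ReZ.
rewrite (raddf_sum (@complex.Re R : Rcomplex R -> R)).
set S1 := \sum_(k < _) _; set S2 := \sum_(k < _) _; set S3 := \sum_(k < _) _.
suff : 2 * S2 <= S1 + S3.
  move=> h; have pi0 := pi_ge0 R.
  have : 0 <= 2 * pi * (S1 + S3 - 2 * S2) by rewrite !mulr_ge0// subr_ge0.
  lra.
rewrite /S1 /S2 /S3 mulr_sumr -big_split; apply: ler_sum => k _.
move: (fourier_coef f _) (a k) => [x y] [v w]; rewrite !normc_sqr/=.
by have := sqr_ge0 (x - v); have := sqr_ge0 (y - w); nra.
Qed.

End Bessel.

(** * Sampled cosine-power kernels *)

Section CosineKernel.
Variable R : realType.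
Implicit Types (c : R -> R[i]) (x s t : R) (z : R[i]).

Lemma expiX s n : expi s ^+ n = expi (n%:R * s).
Proof.
elim: n => [|n IH]; first by rewrite mul0r expi0.
by rewrite exprS IH -expiD -natr1; congr expi; ring.
Qed.

Lemma cos_neq1 s : 0 < `|s| < 2 * pi -> cos s != 1.
Proof.
rewrite -(cos_norm s) => /andP[s0 s1].
have := @sin_gt0_pi _ (`|s| / 2); have -> : 0 < `|s| / 2 < pi by apply/andP; split; lra.
move=> /(_ isT) h; have -> : `|s| = (`|s| / 2) *+ 2 by rewrite -mulr_natr divfK.
rewrite cos_mulr2n; have := cos2Dsin2 (`|s| / 2).
move: h; move: (sin _) (cos _) => a b h e.
by apply/eqP; rewrite -[b ^+ 2 *+ 2]mulr_natl => ?; nra.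
Qed.

Lemma sum_character_nodes (m : int) (M : nat) x : (0 < M)%N -> m != 0 -> (`|m| < M)%N ->
  \sum_(k < M) expi (m%:~R * (x - 2 * pi * k%:R / M%:R)) = 0.
Proof.
move=> M0 m0 mM; have M0' : M%:R != 0 :> R by rewrite pnatr_eq0 -lt0n.
pose z : R[i] := expi (- (m%:~R * (2 * pi / M%:R))).
have zM : z ^+ M = 1.
  rewrite expiX; have -> : M%:R * - (m%:~R * (2 * pi / M%:R)) = (- m)%:~R * (2 * pi) :> R.
    by rewrite mulrNz; move: (@pi R) => p; field.
  exact: expi2piz.
have z1 : z != 1.
  apply/eqP => /(congr1 (@complex.Re R))/=; apply/eqP; apply: cos_neq1.
  have pi0 := pi_gt0 R; have Mp : 0 < M%:R :> R by rewrite ltr0n.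
  rewrite normrN normrM [X in _ * X]ger0_norm ?divr_ge0 ?mulr_ge0 ?ltW//.
  rewrite mulr_gt0 ?divr_gt0 ?mulr_gt0// ?normr_gt0 ?intr_eq0//=.
  rewrite mulrCA gtr_pMr ?mulr_gt0// ltr_pdivrMr// mul1r.
  by rewrite -intr_norm -[M%:R]/((M : int)%:~R) ltr_int; lia.
transitivity (expi (m%:~R * x) * \sum_(k < M) z ^+ k).
  rewrite mulr_sumr; apply: eq_bigr => k _; rewrite expiX -expiD; congr expi.
  by move: (@pi R) => p; field.
have := subrX1 z M; rewrite zM subrr => /esym/eqP; rewrite mulf_eq0 subr_eq0 (negbTE z1)/=.
by move=> /eqP ->; rewrite mulr0.
Qed.

(** A nonnegative trigonometric polynomial of degree [n] which concentrates at
    the origin as [n] grows, with coefficients given by the binomial theorem. *)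
Definition coskernel n s : R := ((1 + cos s) / 2) ^+ n.

Lemma coskernel_ge0 n s : 0 <= coskernel n s.
Proof. by rewrite exprn_ge0// divr_ge0//; have := cos_geN1 s; lra. Qed.

Lemma coskernelE n s : (coskernel n s)%:C%C =
  \sum_(j < n.*2.+1) (('C(n.*2, j))%:R / 4 ^+ n) * expi ((j%:Z - n%:Z)%:~R * s) :> R[i].
Proof.
have e1 : ((1 + cos s) / 2)%:C%C = expi (- s) * (expi s + 1) ^+ 2 / 4 :> R[i].
  have -> : expi (- s) * (expi s + 1) ^+ 2 = expi (- s) * expi s * (expi s + 2) + expi (- s).
    by ring.
  rewrite -expiD addNr expi0 mul1r.
  have -> : expi s + 2 + expi (- s) = ((2 * (1 + cos s))%:C)%C.
    rewrite -(rmorph_nat (real_complex R) 2).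
    by apply: complex_eq; rewrite /expi cosN sinN /=; ring.
  by rewrite -(rmorph_nat (real_complex R)) -fmorphV -rmorphM/=; congr (_%:C)%C; field.
rewrite /coskernel rmorphXn/= e1 expr_div_n exprMn -exprM mul2n exprD1n.
rewrite mulr_sumr mulr_suml; apply: eq_bigr => j _.
rewrite !expiX -[_ *+ 'C(_, _)]mulr_natl rmorphB/=.
have -> : (j%:~R - n%:~R) * s = n%:R * - s + j%:R * s by rewrite -!pmulrn; ring.
by rewrite expiD; ring.
Qed.

(** The mean value of [coskernel n] over the circle. *)
Definition central n : R := ('C(n.*2, n))%:R / 4 ^+ n.

Lemma central_gt0 n : 0 < central n.
Proof. by rewrite divr_gt0 ?exprn_gt0// ltr0n bin_gt0 -addnn leq_addr. Qed.

Lemma central_ratio n : central n.+1 = central n * (1 - (2 * n.+1%:R)^-1).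
Proof.
have h : (n.+1 * 'C(n.+1.*2, n.+1) = 2 * n.*2.+1 * 'C(n.*2, n))%N.
  have e1 := mul_bin_diag n.+1.*2 n; have e2 := mul_bin_diag n.*2.+1 n.
  have e3 : 'C(n.*2.+1, n) = 'C(n.*2.+1, n.+1).
    by rewrite -[RHS]bin_sub; [congr 'C(_, _)|]; lia.
  by rewrite doubleS /= in e1 e2 *; rewrite -e1 e3; nia.
rewrite /central exprS; have : n.+1%:R * ('C(n.+1.*2, n.+1))%:R =
    2 * n.*2.+1%:R * ('C(n.*2, n))%:R :> R by rewrite -!natrM h.
rewrite -[n.*2.+1%:R]natr1 -(muln2 n) natrM muln2.
set a := 'C(_, _)%:R; set b := 'C(_, _)%:R => {}h.
have n1 : n.+1%:R != 0 :> R by rewrite pnatr_eq0.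
have -> : a = 2 * (n%:R * 2 + 1) * b / n.+1%:R by rewrite -h mulrC mulKf.
rewrite -natr1 in n1 *; field.
by rewrite n1 expf_neq0.
Qed.

(** Sampling a trigonometric polynomial of degree less than [M] at [M] equally
    spaced points computes its mean exactly. *)
Lemma sum_coskernel n M x : (n < M)%N ->
  \sum_(k < M) coskernel n (x - 2 * pi * k%:R / M%:R) = M%:R * central n.
Proof.
move=> nM; apply: (@complexI R); rewrite rmorph_sum/=.
under eq_bigr do rewrite coskernelE.
rewrite exchange_big/=.
have nn : (n < n.*2.+1)%N by lia.
rewrite (bigD1 (Ordinal nn))//= [X in _ + X]big1 ?addr0 => [|j jn].
  under eq_bigr do rewrite subrr mul0r expi0 mulr1.
  rewrite sumr_const card_ord -[LHS]mulr_natl /central.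
  by rewrite rmorphM rmorph_nat fmorph_div rmorphXn !rmorph_nat.
rewrite -mulr_sumr sum_character_nodes ?mulr0//; first by lia.
  by rewrite subr_eq0 eqz_nat.
by have := ltn_ord j; lia.
Qed.

End CosineKernel.

Section CosineMeans.
Variable R : realType.
Implicit Types (c : R -> R[i]) (x s t : R) (z : R[i]).

(** There are [n + 2] nodes because the second moment in [sum_weight_cos]
    involves the kernel of degree [n + 1]. *)
Definition node n k : R := 2 * pi * k%:R / n.+2%:R.
Definition weight n k x : R := coskernel n (x - node n k) / (n.+2%:R * central R n).

(** A discrete convolution with the kernel: unlike an integral it is a finite
    sum, and it makes sense for arbitrary functions. *)
Definition cosmean n c x : R[i] := \sum_(k < n.+2) (weight n k x)%:C%C * c (node n k).

Lemma weight_ge0 n k x : 0 <= weight n k x.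
Proof. by rewrite divr_ge0 ?coskernel_ge0// mulr_ge0// ltW// central_gt0. Qed.

Lemma sum_weight n x : \sum_(k < n.+2) weight n k x = 1.
Proof.
rewrite -mulr_suml sum_coskernel// divff// mulf_neq0//; last by rewrite gt_eqF// central_gt0.
Qed.

(** Multiplying by [1 - cos] trades the kernel of degree [n] for that of degree
    [n + 1], and the ratio of their means is explicit. *)
Lemma sum_weight_cos n x :
  \sum_(k < n.+2) weight n k x * (1 - cos (x - node n k)) = n.+1%:R^-1.
Proof.
have C0 := central_gt0 R n; have n0 : 0 < n.+2%:R :> R by rewrite ltr0n.
transitivity ((2 * \sum_(k < n.+2) coskernel n (x - node n k) -
  2 * \sum_(k < n.+2) coskernel n.+1 (x - node n k)) / (n.+2%:R * central R n)).
  rewrite !mulr_sumr -sumrB mulr_suml; apply: eq_bigr => k _.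
  by rewrite /weight /coskernel exprS; field; rewrite !gt_eqF.
rewrite !sum_coskernel// central_ratio.
have n1 : 0 < n.+1%:R :> R by rewrite ltr0n.
by field; rewrite !gt_eqF.
Qed.

Lemma cosmean_trigpoly n c : exists a, cosmean n c = trigpoly n a.
Proof.
exists (fun j => \sum_(k < n.+2) (c (node n k) * ('C(n.*2, j)%:R / 4 ^+ n) /
  (n.+2%:R * central R n)%:C%C * expi (- ((j%:Z - n%:Z)%:~R * node n k)))).
apply/funext => x; rewrite /trigpoly.
under [RHS]eq_bigr do rewrite mulr_suml.
rewrite exchange_big/=; apply: eq_bigr => k _.
rewrite /weight rmorphM/= coskernelE fmorphV !mulr_suml; apply: eq_bigr => j _.
by rewrite mulrBr expiD; ring.
Qed.

Lemma cosmean_bounded n c (B : R) x : (forall t, normc (c t) <= B) ->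
  normc (cosmean n c x) <= B.
Proof.
move=> cB; apply: (le_trans (normc_sum _ _)).
rewrite -[leRHS]mul1r -(sum_weight n x) mulr_suml; apply: ler_sum => k _.
have -> : normc ((weight n k x)%:C%C * c (node n k)) = weight n k x * normc (c (node n k)).
  by rewrite normcM /= expr0n/= addr0 sqrtr_sqr ger0_norm// weight_ge0.
by rewrite ler_wpM2l// weight_ge0.
Qed.

(** Korovkin's argument: a positive averaging process reproduces [c x] up to
    the oscillation of [c], and the part of it controlled by [1 - cos] has a
    small average. *)
Lemma cosmean_dist n c x (e D : R) :
  (forall k, (k < n.+2)%N ->
    normc (c (node n k) - c x) <= e + D * (1 - cos (x - node n k))) ->
  normc (cosmean n c x - c x) <= e + D / n.+1%:R.
Proof.
move=> h; have -> : cosmean n c x - c x =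
    \sum_(k < n.+2) (weight n k x)%:C%C * (c (node n k) - c x).
  under eq_bigr do rewrite mulrBr; rewrite sumrB; congr (_ - _).
  by rewrite -mulr_suml -(rmorph_sum (real_complex R)) sum_weight mul1r.
apply: (le_trans (normc_sum _ _)).
have -> : e + D / n.+1%:R = \sum_(k < n.+2) weight n k x * (e + D * (1 - cos (x - node n k))).
  under [RHS]eq_bigr do rewrite mulrDr mulrCA; rewrite big_split/= -mulr_suml -mulr_sumr.
  by rewrite sum_weight sum_weight_cos mul1r.
apply: ler_sum => k _.
have -> : normc ((weight n k x)%:C%C * (c (node n k) - c x)) =
    weight n k x * normc (c (node n k) - c x).
  by rewrite normcM /= expr0n/= addr0 sqrtr_sqr ger0_norm// weight_ge0.
by rewrite ler_wpM2l ?weight_ge0// h.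
Qed.

Lemma cos_away x t (d : R) : 0 < d -> d <= pi -> d <= x -> x <= 2 * pi - d ->
  0 <= t <= 2 * pi -> d <= `|x - t| -> cos (x - t) <= cos d.
Proof.
move=> d0 dpi dx xd /andP[t0 t1] du; rewrite -(cos_norm (x - t)).
have u2 : `|x - t| <= 2 * pi - d by rewrite ler_norml; apply/andP; split; lra.
move: du u2; move: `|_| => u du u2.
have anti (v : R) : d <= v -> v <= pi -> cos v <= cos d.
  rewrite le_eqVlt => /predU1P[->//|dv] vp; apply: ltW; rewrite ltr_cos//.
    by rewrite in_itv/=; apply/andP; split; lra.
  by rewrite in_itv/=; apply/andP; split; lra.
have [up|/ltW up] := leP u pi; first exact: anti.
rewrite -cosN; have -> : cos (- u) = cos (2 * pi - u).
  by rewrite mulr_natl addrC cosD2pi.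
by apply: anti; lra.
Qed.

Lemma node_itv n k : (k < n.+2)%N -> 0 <= node n k <= 2 * pi.
Proof.
move=> kn; have pi0 := pi_ge0 R; rewrite /node -mulrA.
apply/andP; split; first by rewrite !mulr_ge0// invr_ge0.
rewrite ler_piMr ?mulr_ge0// ler_pdivrMr ?ltr0n// mul1r ler_nat; exact: ltnW.
Qed.

(** Near [x] continuity controls the oscillation of [c]; away from [x],
    [1 - cos] is bounded below and absorbs the bound [2 * B].  The nodes lie in
    one period and [x] is at distance at least [d] from its ends, so that being
    away from [x] on the line means being away from [x] on the circle. *)
Lemma cosmean_cvg c (B : R) x : (forall t, normc (c t) <= B) -> 0 < x < 2 * pi ->
  (forall e : R, 0 < e -> exists2 d : R, 0 < d &
     forall t, `|x - t| < d -> normc (c t - c x) <= e) ->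
  forall e : R, 0 < e -> exists N : nat, forall n : nat, (N <= n)%N ->
    normc (cosmean n c x - c x) <= e.
Proof.
move=> cB /andP[x0 x2] cc e e0; have pi0 := pi_gt0 R.
have [d0 d00 hd] := cc (e / 2) (divr_gt0 e0 (ltr0Sn _ _)).
pose d := Num.min d0 (Num.min pi (Num.min x (2 * pi - x))).
have dle : [/\ 0 < d, d <= d0, d <= pi, d <= x & x <= 2 * pi - d].
  have h : d <= 2 * pi - x by rewrite /d !ge_min lexx !orbT.
  split; [|by rewrite /d ge_min lexx|by rewrite /d !ge_min lexx !orbT|
    by rewrite /d !ge_min lexx !orbT|by lra].
  by rewrite /d !lt_min d00 pi0 x0/= subr_gt0.
have [dp dd0 dpi dx xd] := dle.
have c1 : 0 < 1 - cos d.
  by rewrite subr_gt0 -cos0 ltr_cos// in_itv/=; apply/andP; split; lra.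
have B0 : 0 <= B by apply: le_trans (normc_ge0 _) (cB 0).
pose D := 2 * B / (1 - cos d).
have D0 : 0 <= D by rewrite divr_ge0 ?mulr_ge0// ltW.
exists (Num.bound (D / (e / 2))) => n Nn.
apply: (le_trans (@cosmean_dist n c x (e / 2) D _)).
  move=> k kn; have [lt|ge] := ltP `|x - node n k| d.
    apply: (le_trans (hd _ (lt_le_trans lt dd0))).
    by rewrite lerDl mulr_ge0// subr_ge0 cos_le1.
  apply: (le_trans (le_normcD _ _)); rewrite normcN.
  have : cos (x - node n k) <= cos d by apply: cos_away => //; exact: node_itv.
  move=> cd; have := cB (node n k); have := cB x.
  have : D * (1 - cos d) <= D * (1 - cos (x - node n k)) by rewrite ler_wpM2l//; lra.
  have -> : D * (1 - cos d) = 2 * B by rewrite /D divfK// gt_eqF.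
  lra.
have : D / n.+1%:R <= e / 2.
  rewrite ler_pdivrMr ?ltr0n// mulrC -ler_pdivrMr ?divr_gt0//.
  have /ltW/le_trans := archi_boundP (divr_ge0 D0 (ltW (divr_gt0 e0 (ltr0Sn R 1)))).
  by apply; rewrite ler_nat (leq_trans Nn).
by move=> h; rewrite [leRHS]splitr lerD2l.
Qed.

End CosineMeans.

(** * Density of the trigonometric polynomials *)

Section Density.
Variable R : realType.
Implicit Types (f c : R -> R[i]) (g h : R -> R) (x s t : R) (z : R[i]).
Local Notation mu := (@lebesgue_measure R).
Local Notation I := (`[0, 2 * pi]%classic : set R).

(** Dominated convergence on the open interval: pointwise convergence is only
    available away from the two ends of the period. *)
Lemma dominated_Rintegral_small (k : nat -> R -> R) g (eps : R) :
  (forall n, measurable_fun [set: R] (k n)) ->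
  (forall n t, 0 <= k n t <= g t) -> mu.-integrable I (EFin \o g) ->
  (forall t, 0 < t < 2 * pi -> forall e, 0 < e ->
    exists N, forall n, (N <= n)%N -> k n t <= e) ->
  0 < eps -> exists n, \int[mu]_(t in I) k n t <= eps.
Proof.
move=> mk kg ig kcvg eps0.
pose D : set R := `]0, 2 * pi[%classic.
have mD : measurable D by exact: measurable_itv.
have mkD n : measurable_fun D (EFin \o k n).
  by apply/measurable_EFinP; exact: measurable_funTS.
have eD n : \int[mu]_(t in I) k n t = fine (\int[mu]_(t in D) (k n t)%:E).
  by rewrite /Rintegral (@integral_itv_bndoo _ _ _ _ true false)//; exact: (mkD n).
have igD : mu.-integrable D (EFin \o g).
  have DI : D `<=` I by exact: subset_itv_oo_cc.
  exact: (@integrableS _ _ R mu I D _ (@measurable_period R) mD DI ig).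
have [||//||_ _] := @dominated_convergence _ _ R mu D mD (fun n => EFin \o k n)
    (cst 0%E) (EFin \o g) mkD.
- exact: measurable_cst.
- apply: aeW => t; rewrite /D/= in_itv/= => tD.
  apply: cvg_EFin; first exact: nearW.
  apply/cvgr0Pnorm_le => e e0; have [N hN] := kcvg t tD e e0.
  exists N => // n /= Nn; have /andP[k0 _] := kg n t.
  by rewrite ger0_norm// hN.
- apply: aeW => t n _ /=; have /andP[k0 k1] := kg n t.
  by rewrite lee_fin ger0_norm.
rewrite integral_cst// mul0e => /fine_cvgP[_].
move=> /cvgr0_norm_le => /(_ eps eps0)[N _ hN].
exists N; rewrite eD; apply: le_trans (ler_norm _) _.
exact: (hN N (leqnn N)).
Qed.

Lemma cosmean_L2 g h (M eps : R) : continuous g -> continuous h ->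
  (forall t, `|g t| <= M) -> (forall t, `|h t| <= M) -> 0 < eps ->
  exists n, energy (fun t => cosmean n (fun t => Complex (g t) (h t)) t -
    Complex (g t) (h t)) <= eps.
Proof.
move=> cg ch gM hM eps0; pose c t := Complex (g t) (h t).
have M0 : 0 <= M by apply: le_trans (gM 0).
have cM t : normc (c t) <= 2 * M by exact: normc_Complex_le.
apply: (@dominated_Rintegral_small (fun n t => normc (cosmean n c t - c t) ^+ 2)
  (fun=> (4 * M) ^+ 2)) => //.
- move=> n; apply: measurable_normc2.
  have [a ->] := cosmean_trigpoly n c.
  have [m1 m2] := cmeasurable_trigpoly n a.
  split.
    under eq_fun do rewrite ReB/=; apply: measurable_funB => //.
    exact: continuous_measurable_fun.
  under eq_fun do rewrite ImB/=; apply: measurable_funB => //.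
  exact: continuous_measurable_fun.
- move=> n t; rewrite sqr_ge0 ler_pXn2r ?nnegrE ?normc_ge0 ?mulr_ge0//=.
  apply: (le_trans (le_normcD _ _)); rewrite normcN.
  have := cosmean_bounded n t cM; have := cM t; lra.
- apply: (@bounded_integrable_period _ _ ((4 * M) ^+ 2)) => // t.
  by rewrite ger0_norm ?sqr_ge0.
- move=> t tI e e0.
  (* A distance below 1 is at least its square. *)
  have e1 : 0 < Num.min 1 e by rewrite lt_min ltr01.
  have [|N hN] := cosmean_cvg cM tI _ e1; last first.
    exists N => n Nn; have := hN n Nn; have := normc_ge0 (cosmean n c t - c t).
    by rewrite le_min expr2 => y0 /andP[y1 ye]; nra.
  move=> d d0; have d20 : 0 < d / 2 by rewrite divr_gt0.
  have [d1 /= d1p hd1] := (cvgrPdist_le _ _).1 (cg t) _ d20.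
  have [d2 /= d2p hd2] := (cvgrPdist_le _ _).1 (ch t) _ d20.
  exists (Num.min d1 d2); first by rewrite lt_min d1p.
  move=> s; rewrite lt_min => /andP[/hd1 + /hd2].
  rewrite distrC [X in _ -> X <= _ -> _]distrC => h1 h2.
  suff : normc (c s - c t) ^+ 2 <= d ^+ 2.
    by rewrite ler_pXn2r ?nnegrE ?normc_ge0// ltW.
  rewrite normc_sqr/= -(real_normK (num_real (g s - g t))).
  rewrite -(real_normK (num_real (h s - h t))).
  by have := normr_ge0 (g s - g t); have := normr_ge0 (h s - h t); nra.
Qed.

Definition clip (M y : R) : R := Num.max (- M) (Num.min M y).

Lemma clipP M y : 0 <= M -> [\/ clip M y = M /\ M <= y,
  clip M y = y /\ - M <= y <= M | clip M y = - M /\ y <= - M].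
Proof.
move=> M0; rewrite /clip; case: (leP M y) => h1.
  by rewrite max_r; [constructor 1|lra].
have [h2|h2] := leP (- M) y; first by constructor 2; split=> //; apply/andP; split; lra.
by constructor 3; split => //; exact: ltW.
Qed.

Lemma clip_bounded M y : 0 <= M -> `|clip M y| <= M.
Proof.
move=> M0; rewrite ler_norml.
by case: (clipP y M0) => -[-> h]; apply/andP; split; lra.
Qed.

Lemma clip_id M y : `|y| <= M -> clip M y = y.
Proof.
move=> yM; have M0 : 0 <= M by apply: le_trans yM.
by move: yM; rewrite ler_norml; case: (clipP y M0) => -[-> h] /andP[? ?]; lra.
Qed.

Lemma clip_lip M (x y : R) : 0 <= M -> `|clip M x - clip M y| <= `|x - y|.
Proof.
move=> M0; have := ler_norm (x - y); have := ler_norm (- (x - y)).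
rewrite normrN ler_norml.
case: (clipP x M0) => -[-> h]; case: (clipP y M0) => -[-> h'] *;
  by apply/andP; split; lra.
Qed.

Lemma clip_closer M y : 0 <= M -> `|y - clip M y| <= `|y|.
Proof.
move=> M0; have := ler_norm y; have := ler_norm (- y); rewrite normrN ler_norml.
by case: (clipP y M0) => -[-> h] *; apply/andP; split; lra.
Qed.

Lemma measurable_clip M g : measurable_fun [set: R] g ->
  measurable_fun [set: R] (fun t => clip M (g t)).
Proof. by move=> mg; apply: measurable_maxr => //; exact: measurable_minr. Qed.

Lemma continuous_clip M g : 0 <= M -> continuous g -> continuous (fun t => clip M (g t)).
Proof.
move=> M0 cg x; apply/cvgrPdist_le => e e0; near=> y.
apply: (le_trans (clip_lip (g x) (g y) M0)).
near: y; exact: (cvgrPdist_le _ _).1 (cg x) _ e0.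
Unshelve. all: by end_near. Qed.

(** Truncation at a high level is close in L^2 by dominated convergence.  For
    functions bounded by [M], closeness in L^1 to a continuous function implies
    closeness in L^2, as [(x - y) ^ 2 <= 2 * M * |x - y|]; clipping the
    continuous function at the same level only improves the approximation. *)
Lemma continuous_dense_L2 g (eps : R) : measurable_fun [set: R] g ->
  mu.-integrable I (EFin \o (fun t => g t ^+ 2)) -> 0 < eps ->
  exists h (M : R), [/\ continuous h, forall t, `|h t| <= M &
    \int[mu]_(t in I) (g t - h t) ^+ 2 <= eps].
Proof.
move=> mg ig eps0.
have mc M : measurable_fun [set: R] (fun t => clip M (g t)) := measurable_clip M mg.
have [n hn] : exists n : nat, \int[mu]_(t in I) (g t - clip n%:R (g t)) ^+ 2 <= eps / 4.
  apply: (@dominated_Rintegral_small (fun n t => (g t - clip n%:R (g t)) ^+ 2)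
    (fun t => g t ^+ 2)) => //.
  - by move=> n; apply: measurable_funX; exact: measurable_funB.
  - move=> n t; rewrite sqr_ge0/= -real_normK ?num_real// -[leRHS]real_normK ?num_real//.
    by rewrite ler_pXn2r ?nnegrE// clip_closer.
  - move=> t _ e e0; exists (Num.bound `|g t|) => n Nn.
    rewrite clip_id ?subrr ?expr0n/= ?ltW//.
    by rewrite (lt_le_trans (archi_boundP _))// ler_nat.
  - by rewrite divr_gt0.
pose M : R := n%:R; have M0 : 0 <= M := ler0n R n.
pose k t := clip M (g t).
have mk : measurable_fun [set: R] k := mc M.
have kM t : `|k t| <= M by exact: clip_bounded.
have ik : mu.-integrable I (EFin \o k) by exact: bounded_integrable_period (mc M) kM.
have [g_ [cg_ ig_ /fine_cvgP[fin0 cv]]] :=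
  approximation_continuous_integrable (@measurable_period R) (@lebesgue_measure_period_lty R) ik.
have e8 : 0 < eps / (8 * (M + 1)) by rewrite divr_gt0// mulr_gt0// ltr_wpDl.
move: cv => /cvgr0_norm_le => /(_ _ e8)[N _ hN].
have /= /(le_trans (ler_norm _)) hJ := hN N (leqnn N).
pose h t := clip M (g_ N t).
have mh : measurable_fun [set: R] (g_ N) by exact: continuous_measurable_fun.
have hM t : `|h t| <= M by exact: clip_bounded.
exists h, M; split => //; first exact: continuous_clip.
have i1 : mu.-integrable I (EFin \o (fun t => (g t - k t) ^+ 2)).
  apply: (dominated_integrable_period _ _ ig).
    by apply: measurable_funX; exact: measurable_funB.
  move=> t; rewrite ger0_norm ?sqr_ge0// -real_normK ?num_real// -[leRHS]real_normK ?num_real//.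
  by rewrite ler_pXn2r ?nnegrE// clip_closer.
have i2 : mu.-integrable I (EFin \o (fun t => `|k t - g_ N t|)).
  exact: (integrable_abse (@integrableB _ _ R mu I (@measurable_period R) _ _ ik (ig_ N))).
have i3 : mu.-integrable I (EFin \o (fun t => (g t - h t) ^+ 2)).
  apply: (dominated_integrable_period (k := fun t => 2 * g t ^+ 2 + 2 * M ^+ 2)).
  - by apply: measurable_funX; apply: measurable_funB => //; exact: measurable_clip.
  - move=> t; rewrite ger0_norm ?sqr_ge0//.
    have : h t ^+ 2 <= M ^+ 2.
      by rewrite -real_normK ?num_real// ler_pXn2r ?nnegrE.
    by have := sqr_ge0 (g t + h t); nra.
  - apply: integrable_periodD; first exact: integrable_periodZ.
    apply: (@bounded_integrable_period _ _ (2 * M ^+ 2)) => // t.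
    by rewrite ger0_norm// mulr_ge0// sqr_ge0.
apply: (@le_trans _ _ (\int[mu]_(t in I) (2 * (g t - k t) ^+ 2 + (4 * M) * `|k t - g_ N t|))).
  apply: (@le_Rintegral _ _ R mu I _ _ (@measurable_period R) i3).
    by apply: integrable_periodD; exact: integrable_periodZ.
  move=> t _; have : (k t - h t) ^+ 2 <= 2 * M * `|k t - g_ N t|.
    rewrite -real_normK ?num_real// expr2; apply: ler_pM => //.
      by apply: (le_trans (ler_normB _ _)); have := kM t; have := hM t; lra.
    by rewrite -{1}(clip_id (kM t)); exact: clip_lip.
  by have := sqr_ge0 ((g t - k t) - (k t - h t)); nra.
rewrite Rintegral_periodD; [|exact: integrable_periodZ|exact: integrable_periodZ].
rewrite !Rintegral_periodZ//.
set A := \int[mu]_(t in I) (g t - k t) ^+ 2; set B := \int[mu]_(t in I) `|k t - g_ N t|.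
have hA : A <= eps / 4 := hn.
have hB : B <= eps / (8 * (M + 1)) := hJ.
have : 4 * M * B <= eps / 2.
  apply: (le_trans (ler_wpM2l _ hB)); first by rewrite mulr_ge0.
  have M1 : 0 < M + 1 by lra.
  by rewrite mulrA ler_pdivrMr ?mulr_gt0//; nra.
lra.
Qed.

(** Approximation by continuous functions, not necessarily periodic, then by their
    cosine means, which are trigonometric polynomials and converge to them inside
    the period. *)
Lemma trigpoly_dense f (eps : R) : L2per f -> 0 < eps ->
  exists n a, energy (fun t => f t - trigpoly n a t) <= eps.
Proof.
move=> fL eps0; have /L2perP[fp [m1 m2] fi] := fL.
have e8 : 0 < eps / 8 by rewrite divr_gt0.
have i1 : mu.-integrable I (EFin \o (fun t => complex.Re (f t) ^+ 2)).
  apply: (dominated_integrable_period _ _ fi); first exact: measurable_funX.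
  by move=> t; rewrite ger0_norm ?sqr_ge0// normc_sqr lerDl sqr_ge0.
have i2 : mu.-integrable I (EFin \o (fun t => complex.Im (f t) ^+ 2)).
  apply: (dominated_integrable_period _ _ fi); first exact: measurable_funX.
  by move=> t; rewrite ger0_norm ?sqr_ge0// normc_sqr lerDr sqr_ge0.
have [g [M1 [cg gM hg]]] := continuous_dense_L2 m1 i1 e8.
have [h [M2 [ch hM hh]]] := continuous_dense_L2 m2 i2 e8.
pose M := Num.max M1 M2.
have gM' t : `|g t| <= M by rewrite le_max gM.
have hM' t : `|h t| <= M by rewrite le_max hM orbT.
have e4 : 0 < eps / 4 by rewrite divr_gt0.
pose c t := Complex (g t) (h t).
have [n hn] : exists n, energy (fun t => cosmean n c t - c t) <= eps / 4.
  exact: cosmean_L2 cg ch gM' hM' e4.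
have [a sa] := cosmean_trigpoly n c; rewrite sa in hn.
exists n, a.
have [p1 p2] := cmeasurable_trigpoly n a.
have mg : measurable_fun [set: R] g by exact: continuous_measurable_fun.
have mh : measurable_fun [set: R] h by exact: continuous_measurable_fun.
have M0 : 0 <= M by apply: le_trans (gM' 0).
have sqM (k l : R -> R) : measurable_fun [set: R] k -> measurable_fun [set: R] l ->
    mu.-integrable I (EFin \o (fun t => k t ^+ 2)) -> (forall t, `|l t| <= M) ->
    mu.-integrable I (EFin \o (fun t => (k t - l t) ^+ 2)).
  move=> mk ml ik lM.
  apply: (dominated_integrable_period (k := fun t => 2 * k t ^+ 2 + 2 * M ^+ 2)).
  - by apply: measurable_funX; exact: measurable_funB.
  - move=> t; rewrite ger0_norm ?sqr_ge0//.
    have : l t ^+ 2 <= M ^+ 2.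
      by rewrite -real_normK ?num_real// ler_pXn2r ?nnegrE.
    by have := sqr_ge0 (k t + l t); nra.
  - apply: integrable_periodD; first exact: integrable_periodZ.
    apply: (@bounded_integrable_period _ _ (2 * M ^+ 2)) => // t.
    by rewrite ger0_norm// mulr_ge0// sqr_ge0.
have j1 := sqM _ _ m1 mg i1 gM'; have j2 := sqM _ _ m2 mh i2 hM'.
have [B B0 PB] := trigpoly_bounded n a.
have j3 : mu.-integrable I (EFin \o (fun t => normc (trigpoly n a t - c t) ^+ 2)).
  apply: (@bounded_integrable_period _ _ ((B + 2 * M) ^+ 2)).
    apply: measurable_normc2; split.
      by under eq_fun do rewrite ReB/=; exact: measurable_funB.
    by under eq_fun do rewrite ImB/=; exact: measurable_funB.
  move=> t; rewrite ger0_norm ?sqr_ge0// ler_pXn2r ?nnegrE ?normc_ge0 ?addr_ge0 ?mulr_ge0//.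
  apply: (le_trans (le_normcD _ _)); apply: lerD => //; rewrite normcN.
  exact: normc_Complex_le.
have jf : mu.-integrable I (EFin \o (fun t => normc (f t - trigpoly n a t) ^+ 2)).
  by have /L2perP[] := L2per_sub fL (L2per_trigpoly n a).
apply: (@le_trans _ _ (\int[mu]_(t in I) (2 * ((complex.Re (f t) - g t) ^+ 2 +
    (complex.Im (f t) - h t) ^+ 2) + 2 * normc (trigpoly n a t - c t) ^+ 2))).
  apply: (@le_Rintegral _ _ R mu I _ _ (@measurable_period R) jf).
    by apply: integrable_periodD; apply: integrable_periodZ => //; exact: integrable_periodD.
  move=> t _; have -> : f t - trigpoly n a t = (f t - c t) + - (trigpoly n a t - c t) by ring.
  apply: (le_trans (normcD_sqr_le _ _)); rewrite normcN lerD2r ler_pM2l//.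
  by rewrite normc_sqr ReB ImB.
rewrite Rintegral_periodD; last exact: integrable_periodZ; last first.
  by apply: integrable_periodZ; exact: integrable_periodD.
rewrite !Rintegral_periodZ//; last exact: integrable_periodD.
rewrite Rintegral_periodD//.
set X := \int[mu]_(t in I) (complex.Re (f t) - g t) ^+ 2.
set Y := \int[mu]_(t in I) (complex.Im (f t) - h t) ^+ 2.
set Z := \int[mu]_(t in I) normc (trigpoly n a t - c t) ^+ 2.
have hX : X <= eps / 8 := hg.
have hY : Y <= eps / 8 := hh.
have hZ : Z <= eps / 4 := hn.
lra.
Qed.

End Density.

(** * Uniformly small Fourier tails *)

Section UniformTail.
Variable R : realType.
Implicit Types (f g : R -> R[i]) (t : R) (G : int -> R).
Local Notation mu := (@lebesgue_measure R).
Local Notation I := (`[0, 2 * pi]%classic : set R).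

Definition window_sum n G : R := \sum_(k < n.*2.+1) G (k%:Z - n%:Z).

Lemma fsbig_window n G :
  \sum_(m \in [set m : int | `|m| < n.+1%:Z]) G m = window_sum n G.
Proof.
rewrite /window_sum (fsbig_ord _ _ (fun k : nat => G (k%:Z - n%:Z))).
apply: (@reindex_fsbig _ _ _ _ _ (fun k : nat => k%:Z - n%:Z)).
split.
- by move=> k /=; lia.
- by move=> k l _ _ /=; lia.
- move=> m /= mn; exists (absz (m + n%:Z)) => /=; lia.
Qed.

Lemma window_sum_le n m G : (forall k, 0 <= G k) -> (n <= m)%N ->
  window_sum n G <= window_sum m G.
Proof.
move=> G0; elim: m => [|m IH]; first by rewrite leqn0 => /eqP ->.
rewrite leq_eqVlt => /predU1P[->//|/IH h]; apply: (le_trans h).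
rewrite {2}/window_sum doubleS big_ord_recl big_ord_recr/=.
rewrite [X in _ <= _ + (X + _)](_ : _ = window_sum m G); last first.
  by apply: eq_bigr => k _; congr G; rewrite /= /bump/=; lia.
by rewrite addrCA lerDl addr_ge0.
Qed.

Lemma energyD f g : L2per f -> L2per g ->
  energy (fun t => f t + g t) <= 2 * energy f + 2 * energy g.
Proof.
move=> fL gL; have /L2perP[_ _ fi] := fL; have /L2perP[_ _ gi] := gL.
have /L2perP[_ _ hi] := L2per_add fL gL.
apply: (@le_trans _ _ (\int[mu]_(t in I) (2 * normc (f t) ^+ 2 + 2 * normc (g t) ^+ 2))).
  apply: (@le_Rintegral _ _ R mu I _ _ (@measurable_period R) hi).
    by apply: integrable_periodD; exact: integrable_periodZ.
  by move=> t _; exact: normcD_sqr_le.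
rewrite Rintegral_periodD; [|exact: integrable_periodZ|exact: integrable_periodZ].
by rewrite !Rintegral_periodZ.
Qed.

Lemma energy_le_sup f (e : R) : L2per f -> (forall t, normc (f t) <= e) ->
  energy f <= 2 * pi * e ^+ 2.
Proof.
move=> fL fe; have /L2perP[_ _ fi] := fL; rewrite -Rintegral_period_cst.
apply: (@le_Rintegral _ _ R mu I _ _ (@measurable_period R) fi).
  by apply: (@bounded_integrable_period _ _ (e ^+ 2)) => // t; rewrite ger0_norm ?sqr_ge0.
by move=> t _; rewrite ler_pXn2r ?nnegrE ?normc_ge0// (le_trans _ (fe t)) ?normc_ge0.
Qed.

Lemma energy_iter0 K hbar n f : L2per f -> energy (iter n (Fmap K hbar) f) = energy f.
Proof.
move=> /L2perP[fp mf _]; rewrite /energy.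
under eq_Rintegral do rewrite iter_Fmap normcM normc_expi mul1r.
apply: (@ge0_Rintegral_period _ (fun t => normc (f t) ^+ 2)).
- by move=> t; rewrite fp.
- exact: measurable_normc2.
- by move=> t; exact: sqr_ge0.
Qed.

Lemma trigpoly_dense_finite (F : nat -> R -> R[i]) (M : nat) (e : R) :
  (forall j, L2per (F j)) -> 0 < e -> exists N, forall j, (j < M)%N ->
    exists n a, (n <= N)%N /\ energy (fun t => F j t - trigpoly n a t) <= e.
Proof.
move=> FL e0; elim: M => [|M [N hN]]; first by exists 0%N.
have [n [a ha]] := trigpoly_dense (FL M) e0.
exists (maxn N n) => j; rewrite ltnS leq_eqVlt => /predU1P[->|/hN[n' [a' [n'N h']]]].
  by exists n, a; rewrite leq_maxr.
by exists n', a'; rewrite (leq_trans n'N) ?leq_maxl.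
Qed.

(** Compare [F^n f] with [F^n P], with [F^j P] and with a trigonometric
    polynomial [Q]; the degree of [Q] depends on [j] only, and [j] ranges over
    a finite set. *)
Lemma uniform_tail K hbar f (eps : R) : L2per f -> energy f = 2 * pi -> 0 < eps ->
  exists N : nat, forall n m : nat, (N <= m)%N ->
    1 - eps < window_sum m (fun k => normc (fourier_coef (iter n (Fmap K hbar) f) k) ^+ 2).
Proof.
move=> fL fE eps0; have pi0 := pi_gt0 R.
have pe : 0 < pi * eps by rewrite mulr_gt0.
have [p [b hP]] := trigpoly_dense fL (divr_gt0 pe (ltr0Sn R 5)).
set P := trigpoly p b in hP; have PL : L2per P := L2per_trigpoly p b.
pose e2 := Num.min 1 (eps / 24).
have e20 : 0 < e2 by rewrite lt_min ltr01 divr_gt0.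
have e2e : e2 ^+ 2 <= eps / 24.
  have : e2 <= 1 by rewrite ge_min lexx.
  have : e2 <= eps / 24 by rewrite ge_min lexx orbT.
  by rewrite expr2; nra.
have [M hM] := Fmap_almost_periodic K hbar p b e20.
have PLj j : L2per (iter j (Fmap K hbar) P) := L2per_iter K hbar j PL.
have [N hN] := trigpoly_dense_finite M PLj (divr_gt0 pe (ltr0Sn R 11)).
exists N => n m Nm; set F := iter n (Fmap K hbar) f.
have [j jM hj] := hM n; have [q [a [qN ha]]] := hN j jM.
have FL : L2per F := L2per_iter K hbar n fL.
apply: lt_le_trans (window_sum_le _ (leq_trans qN Nm)); last by move=> k; exact: sqr_ge0.
set W := window_sum q _; set T := energy (fun t => F t - trigpoly q a t).
have hW : 2 * pi - T <= 2 * pi * W.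
  by have := best_approximation q a FL; rewrite {1}/F energy_iter0// fE.
have nL := L2per_iter K hbar n PL; have jL := L2per_iter K hbar j PL.
have tL := L2per_trigpoly (R := R) q a.
(* The three distances enter with weights 2, 4 and 4; each term is at most
   pi * eps / 3. *)
have T1 : T <= 2 * (pi * eps / 6) + 2 * (2 * (2 * pi * e2 ^+ 2) + 2 * (pi * eps / 12)).
  rewrite /T.
  have -> : (fun t => F t - trigpoly q a t) = (fun t => (F t - iter n (Fmap K hbar) P t) +
     ((iter n (Fmap K hbar) P t - iter j (Fmap K hbar) P t) +
      (iter j (Fmap K hbar) P t - trigpoly q a t))).
    by apply/funext => t; ring.
  apply: (le_trans (energyD (L2per_sub FL nL) (L2per_add (L2per_sub nL jL) (L2per_sub jL tL)))).
  apply: lerD; rewrite ler_pM2l//; first by rewrite energy_iter.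
  apply: (le_trans (energyD (L2per_sub nL jL) (L2per_sub jL tL))).
  apply: lerD; rewrite ler_pM2l//.
  by apply: energy_le_sup => //; exact: L2per_sub.
have T2 : T <= pi * eps.
  apply: (le_trans T1); have : pi * e2 ^+ 2 <= pi * (eps / 24) by rewrite ler_pM2l.
  by move=> h; lra.
have : 2 * pi * (1 - eps) < 2 * pi * W by lra.
by rewrite ltr_pM2l// mulr_gt0.
Qed.

End UniformTail.

Theorem theorem4p5 (R : realType) (K hbar : R) (psi : R -> R[i]) :
  K != 0 -> 0 < hbar -> L2per psi -> L2norm psi = 1 ->
  (forall eps : R, 0 < eps ->
     exists N : int, forall n : nat, (1 <= n)%N ->
       1 - eps <
       \sum_(m \in [set m : int | `|m| < N])
         normc (fourier_coef (iter n (Fmap K hbar) psi) m) ^+ 2) /\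
  (exists M : R, forall n : nat,
     (`|u (iter n (Fmap K hbar) psi)| <= M%:E)%E).
Proof.
move=> _ _ fL f1; have pi2 : 0 < 2 * pi :> R by rewrite mulr_gt0// pi_gt0.
have fE : energy psi = 2 * pi.
  have := congr1 (fun x => x ^+ 2) f1; rewrite /L2norm expr1n sqr_sqrtr.
    by move=> h; rewrite -[LHS](mulVKf (lt0r_neq0 pi2)) h mulr1.
  apply: mulr_ge0; first by rewrite invr_ge0 ltW.
  by apply: Rintegral_ge0 => t _; exact: sqr_ge0.
split=> [eps eps0|].
  have [N hN] := uniform_tail K hbar fL fE eps0.
  by exists N.+1%:Z => n _; rewrite fsbig_window; exact: hN.
(* A window that carries more than 3/4 of the mass is too wide for u. *)
have [N hN] := uniform_tail K hbar fL fE (divr_gt0 ltr01 (ltr0Sn R 3)).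
exists N.+1%:R => n; set F := iter n _ _.
(* For m = - 1 the defining sum of u is empty. *)
have lo : ((-1)%:E <= u F)%E.
  apply: ereal_sup_ubound; exists (-1) => //=.
  rewrite (_ : [set j : int | _] = set0) ?fsbig_set0 ?divr_ge0//.
  by apply/seteqP; split => // j /=; lia.
have hi : (u F <= N%:R%:E)%E.
  apply: ge_ereal_sup => _ [m /= hm <-]; rewrite lee_fin -[N%:R]/((N : int)%:~R) ler_int.
  rewrite leNgt; apply/negP; case: m hm => // m hm Nm.
  move: hm; rewrite (_ : [set j : int | _] = [set j : int | `|j| < m.+1%:Z]).
    by rewrite fsbig_window; have := hN n m (ltnW Nm); rewrite -/F; lra.
  by apply/seteqP; split => j /=; lia.
have fu : u F \is a fin_num.
  by rewrite fin_numElt (lt_le_trans (ltNyr _) lo) (le_lt_trans hi (ltry _)).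
rewrite -(fineK fu) in lo hi *; rewrite !lee_fin in lo hi *.
by rewrite ler_norml -natr1; have := ler0n R N; move=> ?; apply/andP; split; lra.
Qed.
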